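(* Let $\gamma=(\mathbf A,\mathbf B,\nu,z,f,f'')$ be a $\mathbb Z$-nondegenerate Neumann-Zagier datum with $N$ tetrahedra, let $k$ be a positive integer, let $\zeta=e^{2\pi i/k}$, and let $\theta_i$ ($1\le i\le N$) be complex numbers with $\theta_i^k=z_i$. Assume that $\sum_{m\in(\mathbb Z/k\mathbb Z)^N}a_m(\theta)\neq0$ and that the matrix $\mathcal H=\frac1k(-\mathbf B^{-1}\mathbf A+\Delta_{z'})$ is invertible. Then all coefficients of the power series $$\phi^+_{\gamma,\zeta}(\hbar)=\mathrm{Av}\big(\langle f_{\mathcal T,\hbar}(x;\theta,m)\rangle\big)\in 1+\hbar\,\mathbb C[[\hbar]]$$ lie in the field $F_k=\mathbb Q(z_1,\dots,z_N,\zeta)$.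
   Context: **Neumann-Zagier datum.** Let $M$ be an oriented hyperbolic 3-manifold with one cusp (for instance a hyperbolic knot complement) and $\mathcal T$ an ideal triangulation of $M$ with $N$ tetrahedra. For a complex shape parameter $z\in\mathbb C\setminus\{0,1\}$ put $z'=(1-z)^{-1}$ and $z''=1-z^{-1}$ (so $zz'z''=-1$). Each oriented ideal tetrahedron has its three pairs of opposite edges labelled by $z_i,z_i',z_i''$ in the cyclic order given by the orientation; which pair of opposite edges carries the distinguished parameter $z_i$ is a choice made for each tetrahedron. A Neumann-Zagier datum of $\mathcal T$ is a tuple $\gamma=(\mathbf A,\mathbf B,\nu,z,f,f'')$ consisting of: (a) two $N\times N$ integer matrices $\mathbf A,\mathbf B$ and a vector $\nu\in\mathbb Z^N$ encoding the coefficients of Thurston's gluing equations of the triangulation ($N-1$ independent equations imposing trivial holonomy around edges, and one equation imposing parabolic holonomy around the cusp), after eliminating the $z_i'$. Explicitly, an edge equation $\sum_i (G_{i}Z_i+G'_{i}Z'_i+G''_{i}Z''_i)=2\pi i$ with $Z_i+Z_i'+Z_i''=i\pi$, where $G_i,G_i',G_i''$ count how many edges of the $i$-th tetrahedron labelled $z_i,z_i',z_i''$ are identified with the given edge, yields a row with entries $G_i-G_i'$ of $\mathbf A$, $G''_i-G'_i$ of $\mathbf B$, and entry $2-\sum_iG_i'$ of $\nu$; the cusp equation, with right-hand side $0$ instead of $2\pi i$, is treated in the same way. (b) an $N$-tuple $z=(z_1,\dots,z_N)$ with $z_i\in\mathbb C\setminus\{0,1\}$ the shape parameters, satisfying $\prod_i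 z_i^{\mathbf A_{ji}}(1-z_i^{-1})^{\mathbf B_{ji}}=(-1)^{\nu_j}$ for $j=1,\dots,N$; here $z$ is the geometric solution. (c) two vectors $f,f''\in\mathbb Z^N$ with $\mathbf Af+\mathbf Bf''=\nu$ (a combinatorial flattening: $f$, $f''$ and $f'=1-f-f''$ label edges of tetrahedra so that the sum around any edge of the triangulation is $2$). It is a known fact (Neumann-Zagier) that $\mathbf A\mathbf B^T$ is symmetric and $(\mathbf A\ \mathbf B)$ has full rank; hence $\mathbf B^{-1}\mathbf A$ is symmetric when $\mathbf B$ is invertible. The datum is called $\mathbb Z$-nondegenerate if $\mathbf B$ is invertible over the integers. Put $\Delta_{z'}=\mathrm{diag}(z_1',\dots,z_N')$. **The weights and the average.** For $m\in(\mathbb Z/k\mathbb Z)^N$, $$a_m(\theta)=e^{-i\pi\,m\cdot\mathbf B^{-1}\mathbf Am}\;\zeta^{\frac12[m\cdot\mathbf B^{-1}\mathbf Am+m\cdot\mathbf B^{-1}\nu]}\prod_{i=1}^N\frac{\theta_i^{-(\mathbf B^{-1}\mathbf Am)_i}}{(\zeta\theta_i^{-1};\zeta)_{m_i}},$$ where $m$ is represented by an integer vector with nonnegative entries (for instance $0\le m_i<k$; the value is independent of the representative), $\zeta^{1/2}=e^{\pi i/k}$, and $(x;q)_n=\prod_{r=0}^{n-1}(1-q^rx)$. For a function $g$ on $(\mathbb Z/k\mathbb Z)^N$ with values in $\mathbb C$ (or, coefficientwise, in $\mathbb C[[\hbar]]$), $$\mathrm{Av}(g)=\frac{\sum_{m}a_m(\theta)g(m)}{\sum_{m}a_m(\theta)},$$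 sums over $m\in(\mathbb Z/k\mathbb Z)^N$. **Formal Gaussian integration.** For a formal power series $g_\hbar(x)$ in $\hbar^{1/2}$ and $x=(x_1,\dots,x_N)$ (each coefficient of a power of $\hbar^{1/2}$ being a polynomial in $x$ in the case at hand), $$\langle g_\hbar(x)\rangle=\frac{\int dx\,e^{-\frac12x^T\mathcal Hx}g_\hbar(x)}{\int dx\,e^{-\frac12x^T\mathcal Hx}}$$ is defined formally by expanding in $x$ and integrating each monomial by Wick's rule: odd-degree monomials give $0$, and $\langle x_{i_1}\cdots x_{i_{2p}}\rangle$ is the sum over all perfect pairings of $\{1,\dots,2p\}$ of the products of $(\mathcal H^{-1})_{i_ai_b}$ over the pairs $\{a,b\}$. **The integrand.** Let $B_n(t)$ be the Bernoulli polynomials, $ue^{tu}/(e^u-1)=\sum_{n\ge0}B_n(t)u^n/n!$, and let $\mathrm{Li}_0(y)=y/(1-y)$, $\mathrm{Li}_{-l}(y)=(y\,\tfrac{d}{dy})^l\,\mathrm{Li}_0(y)$ for $l\ge0$ (rational functions). For one tetrahedron put $$\psi_\hbar(x,\theta,m)=\exp\Bigg(\sum_{\substack{n,j\ge0\\ n+\frac j2-1>0}}\frac{\hbar^{\,n+\frac j2-1}(-1)^j}{n!\,j!\,k^j}\sum_{s=1}^kB_n\Big(\frac sk\Big)\mathrm{Li}_{2-n-j}(\zeta^{m+s}\theta^{-1})\,x^j\Bigg),$$ and for the triangulation $$f_{\mathcal T,\hbar}(x;\theta,m)=\exp\Big(-\frac{\hbar^{1/2}}{2k}x^T\mathbf B^{-1}\nu+\frac{\hbar}{8k}f^T\mathbf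 B^{-1}\nu\Big)\prod_{i=1}^N\psi_\hbar(x_i,\theta_i,m_i).$$ *)

(* Defs.v *)
(* Complex numbers are R[i], for R : realType. *)
From HB Require Import structures.
From mathcomp Require Import all_boot all_order all_fingroup all_algebra.
From mathcomp Require Import complex.
From mathcomp Require Import reals topology normedtype sequences trigo.
(* The notations of mpoly clash with those of the analysis library, so
   {mpoly K[n]} is written [mpoly n K] below. *)
From mathcomp Require Import -(notations) mpoly.

Set Implicit Arguments.
Unset Strict Implicit.
Unset Printing Implicit Defensive.

Import Order.TTheory GRing.Theory Num.Theory.
Import numFieldNormedType.Exports.

Local Open Scope ring_scope.
Local Open Scope complex_scope.

(** * Oriented ideal triangulations of one-cusped manifolds *)

(* Tetrahedron i has vertices labelled by 'I_4, compatibly with its orientation: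
   seen from vertex 0 (put at infinity in the upper half-space model), vertices
   1, 2, 3 are in counterclockwise order.  Face v is the face opposite to vertex
   v.  If [glue i v = (j, s)], face v of i is glued to face s v of j, the vertex
   x != v of that face being sent to s x. *)

Definition I40 : 'I_4 := @Ordinal 4 0 isT.
Definition I41 : 'I_4 := @Ordinal 4 1 isT.
Definition I42 : 'I_4 := @Ordinal 4 2 isT.
Definition I43 : 'I_4 := @Ordinal 4 3 isT.

Definition vertex_glued (N : nat) (glue : 'I_N -> 'I_4 -> 'I_N * 'S_4) :
    rel ('I_N * 'I_4) :=
  fun x y => [exists v : 'I_4, (v != x.2) &&
    (y == ((glue x.1 v).1, (glue x.1 v).2 x.2))].

(* Edges of tetrahedra are pairs (i, e) with e a 2-element set of vertices. *)
Definition edge_glued (N : nat) (glue : 'I_N -> 'I_4 -> 'I_N * 'S_4) :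
    rel ('I_N * {set 'I_4}) :=
  fun x y => [exists v : 'I_4, (v \notin x.2) &&
    (y == ((glue x.1 v).1, (glue x.1 v).2 @: x.2))].

(* All ideal vertices are identified, so that the link of the cusp is a connected
   closed oriented surface made of 4N triangles and 6N sides; its vertices are
   the ends of the edges of the triangulation, so it is a torus iff there are
   exactly N edges. *)
Record ideal_triangulation (N : nat) := IdealTriangulation {
  glue : 'I_N -> 'I_4 -> 'I_N * 'S_4;
  glue_odd : forall i v, odd_perm (glue i v).2;
  glueK : forall i v,
    glue (glue i v).1 ((glue i v).2 v) = (i, ((glue i v).2)^-1%g);
  glue_free : forall i v, ((glue i v).1, (glue i v).2 v) != (i, v);
  one_cusp : forall x y, connect (vertex_glued glue) x y;
  torus_cusp : n_comp (edge_glued glue)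
    [pred x : 'I_N * {set 'I_4} | #|x.2| == 2%N] = N }.

(** * Thurston's gluing equations *)

(* The pair of opposite edges containing the edge {0, l+1}. *)
Definition edge_pair (l : 'I_3) (e : {set 'I_4}) : bool :=
  (e == [set I40; lift I40 l]) || (e == ~: [set I40; lift I40 l]).

(* [q i] is the pair of opposite edges of tetrahedron i which carries z_i; with
   the labels 0, 1, 2 of 'I_3 = Z/3Z standing for z, z', z'', the edge e of
   tetrahedron i has label l iff [edge_pair (q i + l) e]. *)

Definition edge_coef (N : nat) (T : ideal_triangulation N) (q : 'I_N -> 'I_3)
    (E : 'I_N * {set 'I_4}) (i : 'I_N) (l : 'I_3) : int :=
  #|[set e | connect (edge_glued (glue T)) E (i, e) &
             edge_pair (q i + l) e]|%:Z.

(* The link of the ideal vertices consists of the triangles (i, v), with corners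
   on the edges {v, w} and sides on the faces w, for w != v.  A passage
   is an oriented arc in the triangle (tet, frame 0), which enters through the
   side [frame 2], leaves through the side [frame 3], and therefore turns around
   the corner [frame 1]; [depth] is the number of arcs of the curve separating it
   from this corner. *)
Record passage (N : nat) := Passage {
  tet : 'I_N;
  frame : 'S_4;
  depth : nat }.

Definition corner (N : nat) (x : passage N) : 'I_N * 'I_4 * 'I_4 :=
  (tet x, frame x I40, frame x I41).

Definition narcs (N : nat) (g : seq (passage N)) (c : 'I_N * 'I_4 * 'I_4) : nat :=
  count (fun x => corner x == c) g.

(* y continues x across the side [frame 3] of the triangle of x: either around
   the same end of that side, or around the other one, in which case the rank of
   the crossing point has to be counted from the other end. *)
Definition continues (N : nat) (T : ideal_triangulation N)
    (g : seq (passage N)) (x y : passage N) : bool :=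
  let: (j, s) := glue T (tet x) (frame x I43) in
  [&& tet y == j,
      frame y I40 == s (frame x I40),
      frame y I42 == s (frame x I43) &
      ((frame y I41 == s (frame x I41)) && (depth y == depth x)) ||
      ((frame y I41 == s (frame x I42)) &&
       (depth x + depth y + 1 ==
        narcs g (corner x) + narcs g (tet x, frame x I40, frame x I42))%N)].

(* Closed embedded curves on the cusp in normal position. *)
Definition simple_closed_curve (N : nat) (T : ideal_triangulation N)
    (g : seq (passage N)) : bool :=
  [&& path.cycle (continues T g) g,
      uniq [seq (corner x, depth x) | x <- g] &
      all (fun x => depth x < narcs g (corner x))%N g].

(* The holonomy of the curve is the product of the shapes of the corners it turns
   around, to the power 1 or -1 according to the direction. *)
Definition cusp_coef (N : nat) (q : 'I_N -> 'I_3) (g : seq (passage N))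
    (i : 'I_N) (l : 'I_3) : int :=
  \sum_(x <- g | (tet x == i) &&
                 edge_pair (q i + l) [set frame x I40; frame x I41])
    (-1) ^+ odd_perm (frame x).

(* Row j of (A, B, nu) is the equation
   sum_i (C i 0 Z_i + C i 1 Z'_i + C i 2 Z''_i) = rhs * pi * i
   after elimination of the Z'_i. *)
Definition gluing_row (N : nat) (A B : 'M[int]_N) (nu : 'cV[int]_N) (j : 'I_N)
    (C : 'I_N -> 'I_3 -> int) (rhs : int) : Prop :=
  [/\ forall i, A j i = C i 0 - C i 1,
      forall i, B j i = C i 2 - C i 1 &
      nu j 0 = rhs - \sum_i C i 1].

(* Row c is the equation of the cusp, the others are equations of edges. *)
Definition gluing_matrices (N : nat) (T : ideal_triangulation N)
    (q : 'I_N -> 'I_3) (A B : 'M[int]_N) (nu : 'cV[int]_N) : Prop :=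
  exists (c : 'I_N) (g : seq (passage N)) (E : 'I_N -> 'I_N * {set 'I_4}),
    [/\ simple_closed_curve T g,
        gluing_row A B nu c (cusp_coef q g) 0 &
        forall j, j != c ->
          #|(E j).2| = 2%N /\ gluing_row A B nu j (edge_coef T q (E j)) 2].

(** * The geometric solution *)

(* z, z', z'' for l = 0, 1, 2. *)
Definition shape (K : fieldType) (z : K) (l : 'I_3) : K :=
  if l == 0 then z else if l == 1 then (1 - z)^-1 else 1 - z^-1.

(* Paths of tetrahedra are given by a tetrahedron and the sequence of the faces
   which are crossed. *)
Fixpoint path_end (N : nat) (T : ideal_triangulation N) (i : 'I_N)
    (p : seq 'I_4) : 'I_N :=
  if p is v :: p' then path_end T (glue T i v).1 p' else i.

(* Rotation around the edge of tetrahedron i opposite to {u, v}, from face u to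
   face v and through the latter. *)
Definition rotate_edge (N : nat) (T : ideal_triangulation N)
    (t : 'I_N * 'I_4 * 'I_4) : 'I_N * 'I_4 * 'I_4 :=
  let: (i, u, v) := t in
  let: (j, s) := glue T i v in (j, s v, s u).

(* Homotopy of paths in the 3-manifold, whose fundamental groupoid is that of the
   2-complex dual to the triangulation. *)
Inductive homotopic (N : nat) (T : ideal_triangulation N) :
    'I_N -> seq 'I_4 -> seq 'I_4 -> Prop :=
| homotopic_refl i p : homotopic T i p p
| homotopic_sym i p p' : homotopic T i p p' -> homotopic T i p' p
| homotopic_trans i p p' p'' :
    homotopic T i p p' -> homotopic T i p' p'' -> homotopic T i p p''
| homotopic_cons i v p p' :
    homotopic T (glue T i v).1 p p' -> homotopic T i (v :: p) (v :: p')
| homotopic_backtrack i v p :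
    homotopic T i [:: v, (glue T i v).2 v & p] p
| homotopic_edge i u v n p :
    u != v -> iter n (rotate_edge T) (i, u, v) = (i, u, v) ->
    homotopic T i
      ([seq t.2 | t <- traject (rotate_edge T) (i, u, v) n] ++ p) p.

(* The ideal tetrahedron with vertices oo, 0, 1, w in P^1, in homogeneous
   coordinates; w is then the shape of the edge {0, 1}. *)
Definition ideal_vertex (K : fieldType) (w : K) (x : 'I_4) : 'cV[K]_2 :=
  match val x with
  | 0 => delta_mx 0 0
  | 1 => delta_mx 1 0
  | 2 => const_mx 1
  | _ => \col_a (if a == 0 then w else 1)
  end.

(* [M i v] moves the neighbour of tetrahedron i across face v, from its standard
   position, to the position adjacent to i in standard position; it
   is determined up to a scalar. *)
Definition developing (K : fieldType) (N : nat) (T : ideal_triangulation N)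
    (q : 'I_N -> 'I_3) (z : 'I_N -> K) (M : 'I_N -> 'I_4 -> 'M[K]_2) : Prop :=
  let w i := shape (z i) (- q i) in
  forall i v, M i v \in unitmx /\
    forall x, x != v -> exists2 c : K, c != 0 &
      M i v *m ideal_vertex (w (glue T i v).1) ((glue T i v).2 x) =
      c *: ideal_vertex (w i) x.

Fixpoint holonomy (K : fieldType) (N : nat) (T : ideal_triangulation N)
    (M : 'I_N -> 'I_4 -> 'M[K]_2) (i : 'I_N) (p : seq 'I_4) : 'M[K]_2 :=
  if p is v :: p' then M i v *m holonomy T M (glue T i v).1 p' else 1%:M.

(* Signed volume of an ideal tetrahedron, i.e. the Bloch-Wigner dilogarithm of z,
   by the formula
   D(z) = (D(z/zb) + D(z'/zb') + D(z''/zb''))/2  (zb the complex conjugate)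
   and D(u) = sum_(n >= 1) Im(u^n)/n^2 for |u| = 1. *)
Definition ideal_volume (R : realType) (z : R[i]) : R :=
  limn (series (fun n : nat =>
    2^-1 * (\sum_(l : 'I_3)
      complex.Im ((shape z l / (shape z l)^*) ^+ n.+1)) / n.+1%:R ^+ 2)).

(* z is the solution of the gluing equations giving the complete hyperbolic
   structure of the oriented manifold: its holonomy representation in PGL_2(C) is
   faithful with discrete image, and its volume is positive (by Mostow-Prasad
   rigidity, the only other conjugacy class of discrete faithful representations
   is the complex conjugate, which has the opposite volume). *)
Definition geometric_solution (R : realType) (N : nat)
    (T : ideal_triangulation N) (q : 'I_N -> 'I_3) (z : 'I_N -> R[i]) : Prop :=
  (exists2 M, developing T q z M & forall i : 'I_N,
     (forall p, path_end T i p = i -> is_scalar_mx (holonomy T M i p) ->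
        homotopic T i p [::]) /\
     (exists2 eps : R, 0 < eps & forall p (c : R[i]),
        path_end T i p = i -> \det (c *: holonomy T M i p) = 1 ->
        (forall a b, `|(c *: holonomy T M i p - 1%:M) a b| < eps%:C) ->
        c *: holonomy T M i p = 1%:M)) /\
  0 < \sum_i ideal_volume (z i).

(** * Neumann-Zagier data *)

(* The symmetry of A B^T and the full rank of (A B) hold for the matrices of the
   gluing equations by a theorem of Neumann and Zagier, as soon as the N - 1 edge
   equations are independent and the curve on the cusp is essential. *)
Definition NZ_datum (R : realType) (N : nat) (T : ideal_triangulation N)
    (A B : 'M[int]_N) (nu : 'cV[int]_N) (z : 'I_N -> R[i])
    (f f'' : 'cV[int]_N) : Prop :=
  exists q : 'I_N -> 'I_3,
    [/\ gluing_matrices T q A B nu,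
        A *m B^T = (A *m B^T)^T /\
        row_free (map_mx intr (row_mx A B) : 'M[rat]_(N, N + N)),
        (forall i, z i != 0 /\ z i != 1) /\
        (forall j, \prod_i (z i ^ A j i * (1 - (z i)^-1) ^ B j i)
                   = (-1) ^ nu j 0),
        geometric_solution T q z &
        A *m f + B *m f'' = nu].

Definition Z_nondegenerate (N : nat) (B : 'M[int]_N) : bool := B \in unitmx.

(** * The weights and the average *)

Definition expi (R : realType) (t : R) : R[i] := cos t +i* sin t.

Definition zeta (R : realType) (k : nat) : R[i] := expi (2 * pi / k%:R).

Definition qpoch (K : fieldType) (x q : K) (n : nat) : K :=
  \prod_(r < n) (1 - q ^+ r * x).

Definition dot (N : nat) (u v : 'cV[int]_N) : int := (u^T *m v) 0 0.

Definition weight (R : realType) (N k : nat) (A B : 'M[int]_N)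
    (nu : 'cV[int]_N) (theta : 'I_N -> R[i]) (m : 'I_N -> nat) : R[i] :=
  let mZ : 'cV[int]_N := \col_i (m i)%:Z in
  let BAm := invmx B *m A *m mZ in
  expi (- (pi * (dot mZ BAm)%:~R)) *
  expi (pi / k%:R) ^ (dot mZ BAm + dot mZ (invmx B *m nu)) *
  \prod_i (theta i ^ (- BAm i 0) /
           qpoch (zeta R k / theta i) (zeta R k) (m i)).

(* (Z/kZ)^N is represented by the vectors with entries in {0, ..., k-1}. *)
Definition weight_sum (R : realType) (N k : nat) (A B : 'M[int]_N)
    (nu : 'cV[int]_N) (theta : 'I_N -> R[i]) : R[i] :=
  \sum_(m : {ffun 'I_N -> 'I_k}) weight k A B nu theta (fun i => m i).

Definition Av (R : realType) (N k : nat) (A B : 'M[int]_N) (nu : 'cV[int]_N)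
    (theta : 'I_N -> R[i]) (g : ('I_N -> nat) -> R[i]) : R[i] :=
  (\sum_(m : {ffun 'I_N -> 'I_k})
     weight k A B nu theta (fun i => m i) * g (fun i => m i)) /
  weight_sum k A B nu theta.

(** * Formal power series in hbar^(1/2) *)

(* [a p] is the coefficient of hbar^(p/2). *)
Definition hseries (V : Type) := nat -> V.

Definition hs_one (V : nzRingType) : hseries V := fun p => (p == 0%N)%:R.

Definition hs_mul (V : nzRingType) (a b : hseries V) : hseries V :=
  fun p => \sum_(r < p.+1) a r * b (p - r)%N.

(* exp(a) = sum_r a^r / r!, for a without constant term: the terms with r > p do
   not contribute to the coefficient p. *)
Definition hs_exp (K : fieldType) (V : algType K) (a : hseries V) : hseries V :=
  fun p => \sum_(r < p.+1) (r`!%:R)^-1 *: iter r (hs_mul a) (hs_one V) p.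

(** * Formal Gaussian integration *)

Definition perfect_pairing (d : nat) (s : 'S_d) : bool :=
  [forall a, (s a != a) && (s (s a) == a)].

(* A perfect pairing is given by the fixed-point free involution exchanging the
   two elements of each pair; Hinv is the (symmetric) matrix of covariances. *)
Definition wick (K : fieldType) (N d : nat) (Hinv : 'M[K]_N)
    (t : d.-tuple 'I_N) : K :=
  \sum_(s : 'S_d | perfect_pairing s)
    \prod_(a : 'I_d | (a < s a)%N) Hinv (tnth t a) (tnth t (s a)).

(* The indices of the variables of a monomial, with multiplicities. *)
Definition mon_indices (N : nat) (mu : multinom N) : seq 'I_N :=
  flatten [seq nseq (mu i) i | i <- enum 'I_N].

Definition gauss (K : fieldType) (N : nat) (Hinv : 'M[K]_N) (g : mpoly N K) : K :=
  \sum_(mu <- msupp g) mcoeff mu g * wick Hinv (in_tuple (mon_indices mu)).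

(** * The integrand *)

(* Bernoulli polynomials: comparing the coefficients of u^(n+1) in
   (e^u - 1) * sum_n B_n(t) u^n/n! = u e^(tu)  gives the recursion, and
   conversely (see [bernoulliE]). *)
Fixpoint bernoulli_seq (K : fieldType) (n : nat) : seq {poly K} :=
  if n is n'.+1 then
    let s := bernoulli_seq K n' in
    rcons s ('X^n' - (n'.+1%:R)^-1 *: \sum_(i < n') s`_i *+ 'C(n'.+1, i))
  else [::].

Definition bernoulli (K : fieldType) (n : nat) : {poly K} :=
  (bernoulli_seq K n.+1)`_n.

Lemma size_bernoulli_seq (K : fieldType) (n : nat) :
  size (bernoulli_seq K n) = n.
Proof. by elim: n => //= n IHn; rewrite size_rcons IHn. Qed.

Lemma nth_bernoulli_seq (K : fieldType) (n i : nat) :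
  (i < n)%N -> (bernoulli_seq K n)`_i = bernoulli K i.
Proof.
elim: n => // n IHn; rewrite ltnS leq_eqVlt => /predU1P[->//|lt_in].
by rewrite /= nth_rcons size_bernoulli_seq lt_in IHn.
Qed.

Lemma bernoulliE (K : numFieldType) (n : nat) :
  \sum_(i < n.+1) bernoulli K i *+ 'C(n.+1, i) = 'X^n *+ n.+1.
Proof.
rewrite big_ord_recr /= binSn [bernoulli K n]/bernoulli /=.
rewrite nth_rcons size_bernoulli_seq ltnn eqxx.
rewrite (eq_bigr (fun i : 'I_n => (bernoulli_seq K n)`_i *+ 'C(n.+1, i))); last first.
  by move=> i _; rewrite nth_bernoulli_seq.
set S := \sum_(i < n) _.
rewrite mulrnBl -[X in _ - X]scaler_nat scalerA mulfV ?scale1r ?pnatr_eq0 //.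
by rewrite addrC subrK.
Qed.

(* Rational functions are represented by pairs (numerator, denominator);
   [euler] is y d/dy. *)
Definition euler (K : fieldType) (r : {poly K} * {poly K}) :
    {poly K} * {poly K} :=
  ('X * (r.1^`() * r.2 - r.1 * r.2^`()), r.2 ^+ 2).

(* Li_(-l)(y) *)
Definition Li_neg (K : fieldType) (l : nat) (y : K) : K :=
  let r := iter l (@euler K) ('X, 1 - 'X) in r.1.[y] / r.2.[y].

(* The logarithm of psi_hbar(x, th, m).  The terms of degree p/2 > 0 in hbar are
   those with 2n + j - 2 = p; for them n + j - 2 >= 0. *)
Definition log_psi (R : realType) (V : algType R[i]) (k : nat) (x : V)
    (th : R[i]) (m : nat) : hseries V :=
  fun p => if p == 0%N then 0 else
    \sum_(n < p.+3) \sum_(j < p.+3 | (2 * n + j == p + 2)%N)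
      ((-1) ^+ j / (n`!%:R * j`!%:R * k%:R ^+ j) *
       \sum_(1 <= s < k.+1)
          (bernoulli R[i] n).[s%:R / k%:R] *
          Li_neg (n + j - 2) (zeta R k ^+ (m + s) / th)) *: x ^+ j.

Definition psi (R : realType) (V : algType R[i]) (k : nat) (x : V)
    (th : R[i]) (m : nat) : hseries V := hs_exp (log_psi k x th m).

Definition xvar (R : realType) (N : nat) (i : 'I_N) : mpoly N R[i] :=
  mpolyX R[i] (mnm1 i).

Definition log_prefactor (R : realType) (N k : nat) (B : 'M[int]_N)
    (nu f : 'cV[int]_N) : hseries (mpoly N R[i]) :=
  let Bnu := invmx B *m nu in
  fun p =>
    if p == 1%N then
      - (2 * k%:R)^-1 *: \sum_i ((Bnu i 0)%:~R : R[i]) *: xvar R i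
    else if p == 2%N then ((8 * k%:R)^-1 * (dot f Bnu)%:~R)%:A
    else 0.

Definition integrand (R : realType) (N k : nat) (B : 'M[int]_N)
    (nu f : 'cV[int]_N) (theta : 'I_N -> R[i]) (m : 'I_N -> nat) :
    hseries (mpoly N R[i]) :=
  hs_mul (hs_exp (log_prefactor R k B nu f))
    (\big[@hs_mul _/hs_one _]_(i < N) psi k (xvar R i) (theta i) (m i)).

(* H = (- B^-1 A + Delta_z') / k *)
Definition hessian (R : realType) (N k : nat) (A B : 'M[int]_N)
    (z : 'I_N -> R[i]) : 'M[R[i]]_N :=
  k%:R^-1 *: (- map_mx intr (invmx B *m A) + diag_mx (\row_i (1 - z i)^-1)).

Definition phi_plus (R : realType) (N k : nat) (A B : 'M[int]_N)
    (nu f : 'cV[int]_N) (z theta : 'I_N -> R[i]) : hseries R[i] :=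
  fun p => Av k A B nu theta (fun m =>
    gauss (invmx (hessian k A B z)) (integrand k B nu f theta m p)).

(** * The field F_k = Q(z_1, ..., z_N, zeta) *)

(* The intersection of all subfields of C containing the z_i and zeta. *)
Definition in_Fk (R : realType) (N k : nat) (z : 'I_N -> R[i]) (x : R[i]) : Prop :=
  forall F : {pred R[i]}, divring_closed F ->
    (forall i, z i \in F) -> zeta R k \in F -> x \in F.

(* Main.v *)
(* Let F be a subfield of C containing the z_i and zeta.  Replacing theta_i by
   theta_i / zeta^(c_i) multiplies all the weights by a common factor and shifts
   the index m by c, both in the weights and in the integrand, so that the average
   does not change.  An element of F(theta) which is invariant under these twists
   lies in F, as one sees by averaging over the twists a polynomial expression in
   theta with coefficients in F.

   The weights lie in F(theta), although zeta^(1/2) need not: this requires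
   m.B^-1 A m + m.B^-1 nu to be even, i.e. the diagonal of A B^T to be congruent to
   nu modulo 2.  If e(i, _) counts how often the edges of tetrahedron i occur in an
   equation with coefficients C_i, C'_i, C''_i, and K(i, w) is the sum of e(i, _) over
   the edges of face w, then
     C_i C'_i + C'_i C''_i + C''_i C_i = sum_w binomial(K(i, w), 2)  mod 2,
   and the sum of the right-hand sides over all i is even, because glued faces have
   the same K. *)
From HB Require Import structures.
Require Import Defs.
From mathcomp Require Import all_boot all_order all_fingroup all_algebra.
From mathcomp Require Import complex reals trigo.
From mathcomp Require Import -(notations) mpoly.
From mathcomp Require boolp.
From mathcomp Require Import zify ring.

Set Implicit Arguments.
Unset Strict Implicit.
Unset Printing Implicit Defensive.

Import Order.TTheory GRing.Theory Num.Theory.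
Local Open Scope ring_scope.
Local Open Scope complex_scope.

(** * Parity of the gluing equations *)

(** Each orbit consists of two elements with equal terms; the half-sum keeps the one of smaller
    [enum_rank]. *)
Lemma sum_involution (V : nmodType) (T : finType) (P : pred T) (s : T -> T)
    (F : T -> V) :
  (forall x, P x -> P (s x)) -> (forall x, P x -> s (s x) = x) ->
  (forall x, P x -> s x != x) -> (forall x, P x -> F (s x) = F x) ->
  exists y, \sum_(x | P x) F x = y *+ 2.
Proof.
move=> sP sK s_free sF.
exists (\sum_(x | P x && (enum_rank x < enum_rank (s x))%N) F x).
rewrite (bigID (fun x => (enum_rank x < enum_rank (s x))%N)) mulr2n; congr (_ + _).
(* [t] extends [s] by the identity outside [P], which gives a permutation of the whole type. *)
pose t x := if P x then s x else x.
have tK : involutive t.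
  by move=> x; rewrite /t; case: (boolP (P x)) => [Px|/negPf->//]; rewrite sP ?sK.
rewrite (reindex_inj (inv_inj tK)); apply: eq_big => [x|x /andP[]]; rewrite /t.
  case: (boolP (P x)) => [Px|/negPf->//]; rewrite sP ?sK //= -leqNgt leq_eqVlt.
  by rewrite (inj_eq val_inj) (inj_eq enum_rank_inj) eq_sym (negPf (s_free _ Px)).
by case: (boolP (P x)) => [Px|/negPf->//] _ _; rewrite sF.
Qed.

Lemma edge_pair_sum (n : {set 'I_4} -> nat) (l : 'I_3) :
  (\sum_(e | edge_pair l e) n e =
   n [set I40; lift I40 l] + n (~: [set I40; lift I40 l]))%N.
Proof.
set e := [set _; _].
rewrite (bigD1 e) /=; last by rewrite /edge_pair eqxx.
rewrite (bigD1 (~: e)) /=; last first.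
  rewrite /edge_pair eqxx orbT /=; apply/eqP=> /setP/(_ I40).
  by rewrite !inE eqxx.
rewrite big1 ?addn0 // => f /andP[/andP[]]; rewrite /edge_pair.
by case/orP=> ->.
Qed.

Lemma bin2D (a b : nat) : 'C(a + b, 2) = ('C(a, 2) + 'C(b, 2) + a * b)%N.
Proof.
elim: a => [|a IHa]; first by rewrite add0n mul0n addn0.
rewrite addSn !binS IHa !bin1; ring.
Qed.

Lemma forall_I4 (P : pred 'I_4) : P I40 -> P I41 -> P I42 -> P I43 -> forall x, P x.
Proof.
move=> P0 P1 P2 P3 [[|[|[|[|//]]]] h].
- by rewrite (_ : Ordinal h = I40) //; apply: val_inj.
- by rewrite (_ : Ordinal h = I41) //; apply: val_inj.
- by rewrite (_ : Ordinal h = I42) //; apply: val_inj.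
- by rewrite (_ : Ordinal h = I43) //; apply: val_inj.
Qed.

(** The number K(i, w): the complements of the sets {w, x} are the three edges of face w. *)
Definition face_sum (n : {set 'I_4} -> nat) (w : 'I_4) : nat :=
  \sum_(x | x != w) n (~: [set w; x]).

Definition sigma2 (c : 'I_3 -> int) : int := c 0 * c 1 + c 1 * c 2 + c 2 * c 0.

(** The labels are permuted cyclically, so the choice of the distinguished edges does not affect the
    parity. *)
Lemma sigma2_shift (c : 'I_3 -> int) (q : 'I_3) :
  sigma2 (fun l => c (q + l)) = sigma2 c.
Proof.
have cE i j : val i = val j -> c i = c j by move=> /val_inj->.
rewrite /sigma2; case: q => [[|[|[|//]]]] h /=.
- rewrite (cE (Ordinal h + 0) 0) // (cE (Ordinal h + 1) 1) // (cE (Ordinal h + 2) 2) //.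
- rewrite (cE (Ordinal h + 0) 1) // (cE (Ordinal h + 1) 2) // (cE (Ordinal h + 2) 0) //; ring.
- rewrite (cE (Ordinal h + 0) 2) // (cE (Ordinal h + 1) 0) // (cE (Ordinal h + 2) 1) //; ring.
Qed.

Lemma eq_set_I4 (A B : {set 'I_4}) :
  [&& (I40 \in A) == (I40 \in B), (I41 \in A) == (I41 \in B),
      (I42 \in A) == (I42 \in B) & (I43 \in A) == (I43 \in B)] -> A = B.
Proof.
case/and4P=> H0 H1 H2 H3; apply/setP => v; apply/eqP; move: v.
exact: forall_I4.
Qed.

Lemma sum_I4 (P : pred 'I_4) (F : 'I_4 -> nat) : (\sum_(x | P x) F x =
  P I40 * F I40 + P I41 * F I41 + P I42 * F I42 + P I43 * F I43)%N.
Proof.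
rewrite big_mkcond /= !big_ord_recl big_ord0 addn0 -!addnA.
by congr (_ + (_ + (_ + _)))%N; rewrite mulnbl; congr (if P _ then F _ else _); apply: val_inj.
Qed.

(* Two edges in different pairs of opposite edges lie on exactly one common face. *)
Lemma sigma2_face_sum (n : {set 'I_4} -> nat) :
  exists y : int, (\sum_w 'C(face_sum n w, 2))%N%:Z =
    sigma2 (fun l => (\sum_(e | edge_pair l e) n e)%N%:Z) + 2 * y.
Proof.
pose a x y := n [set x; y]; pose b x y := n (~: [set x; y]).
have aC x y : a x y = a y x by rewrite /a setUC.
have bC x y : b x y = b y x by rewrite /b setUC.
have b12 : b I41 I42 = a I40 I43.
  by congr n; apply: eq_set_I4; rewrite !inE.
have b13 : b I41 I43 = a I40 I42.
  by congr n; apply: eq_set_I4; rewrite !inE.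
have b23 : b I42 I43 = a I40 I41.
  by congr n; apply: eq_set_I4; rewrite !inE.
have E l l' : lift I40 l = l' ->
    (\sum_(e | edge_pair l e) n e = a I40 l' + b I40 l')%N.
  by move<-; rewrite edge_pair_sum.
rewrite /sigma2 (E 0 I41) ?(E 1 I42) ?(E 2 I43); try exact: val_inj.
rewrite sum_I4 /face_sum !sum_I4 /= -!/(b _ _) !mul0n !mul1n !add0n ?addn0.
rewrite !(bC I41 I40) !(bC _ I40) !(bC I43) !(bC I42 I41) b12 b13 b23 !bin2D.
(* Each edge lies on two faces, so its own binomial occurs twice in the expansion by [bin2D]. *)
exists ('C(a I40 I41, 2) + 'C(a I40 I42, 2) + 'C(a I40 I43, 2) +
        'C(b I40 I41, 2) + 'C(b I40 I42, 2) + 'C(b I40 I43, 2))%N%:Z.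
lia.
Qed.
Section Parity.
Variables (N : nat) (T : ideal_triangulation N).

Definition face_glue (p : 'I_N * 'I_4) : 'I_N * 'I_4 :=
  ((glue T p.1 p.2).1, (glue T p.1 p.2).2 p.2).

Lemma face_glueK : involutive face_glue.
Proof.
by case=> i w; rewrite /face_glue /= glueK /= permK.
Qed.

Lemma sum_face_even (F : 'I_N * 'I_4 -> int) :
  (forall p, F (face_glue p) = F p) -> exists y, \sum_p F p = 2 * y.
Proof.
move=> F_inv.
have [//|p _|[i w] _|p _|y ->] := @sum_involution _ _ predT face_glue F.
- exact: face_glueK.
- exact: glue_free.
- exact: F_inv.
by exists y; rewrite mulr_natl.
Qed.

Lemma sigma2_sum_even (n : 'I_N -> {set 'I_4} -> nat) (q : 'I_N -> 'I_3) :
  (forall p, face_sum (n (face_glue p).1) (face_glue p).2 =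
             face_sum (n p.1) p.2) ->
  exists y, \sum_i sigma2 (fun l => (\sum_(e | edge_pair (q i + l)%R e) n i e)%N%:Z)
            = 2 * y.
Proof.
move=> n_inv.
have [p|y Ey] := @sum_face_even (fun p => 'C(face_sum (n p.1) p.2, 2)%:Z).
  by rewrite n_inv.
have /fin_all_exists[x Ex] := fun i => sigma2_face_sum (n i).
exists (y - \sum_i x i); rewrite mulrBr -Ey mulr_sumr.
rewrite -(pair_bigA _ (fun i w => 'C(face_sum (n i) w, 2)%:Z)) /= -sumrB.
apply: eq_bigr => i _; rewrite (sigma2_shift (fun l => (\sum_(e | edge_pair l e) n i e)%N%:Z)).
by apply/eqP; rewrite eq_sym subr_eq -Ex -(big_morph _ PoszD (erefl 0%:Z)).
Qed.

(** Modulo 2, (C - C')(C'' - C') is [sigma2] of the coefficients plus C', and the C' add up to [nu]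
    because the right-hand side is even. Asking the coefficients to agree with the counts [n] only
    modulo 2 allows for the signs in the cusp equation. *)
Lemma gluing_row_parity (A B : 'M[int]_N) (nu : 'cV[int]_N) (j : 'I_N)
    (C : 'I_N -> 'I_3 -> int) (rhs : int) (n : 'I_N -> {set 'I_4} -> nat)
    (q : 'I_N -> 'I_3) :
  (forall p, face_sum (n (face_glue p).1) (face_glue p).2 =
             face_sum (n p.1) p.2) ->
  (forall i l, exists y,
     C i l = (\sum_(e | edge_pair (q i + l)%R e) n i e)%N%:Z + 2 * y) ->
  gluing_row A B nu j C (2 * rhs) ->
  exists y, (A *m B^T) j j = nu j 0 + 2 * y.
Proof.
move=> n_inv Cn [EA EB ->]; have [y Ey] := sigma2_sum_even q n_inv.
have {}Cn : forall il : 'I_N * 'I_3, exists y,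
     C il.1 il.2 = (\sum_(e | edge_pair (q il.1 + il.2)%R e) n il.1 e)%N%:Z + 2 * y.
  by case=> i l; apply: Cn.
have [h Eh] := fin_all_exists Cn.
have Eh' i l := Eh (i, l).
have /fin_all_exists[x Ex] i : exists x, A j i * B j i =
   sigma2 (fun l => (\sum_(e | edge_pair (q i + l)%R e) n i e)%N%:Z) - C i 1 + 2 * x.
  rewrite EA EB /sigma2 !Eh' /=.
  set c0 := Posz _; set c1 := Posz _; set c2 := Posz _.
  (* This replaces the square of [c1] by [- c1] modulo 2. *)
  have [d Ed] : exists d, c1 * (c1 + 1) = 2 * d.
    rewrite /c1; set n1 := (\sum_(_ | _) _)%N; exists (n1 * n1.+1)./2%:Z.
    have : ~~ odd (n1 * n1.+1) by rewrite oddM /= andbN.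
    by move/even_halfK; lia.
  set h0 := h _; set h1 := h _; set h2 := h _.
  pose r := h1 - c0 * c1 - c1 * c2 + c0 * (h2 - h1) + (h0 - h1) * c2 +
    2 * (h0 - h1) * (h2 - h1) - c1 * (h2 - h1) - (h0 - h1) * c1.
  exists (d + r); rewrite (mulrDr 2 d r) -Ed /r; ring.
exists (y + \sum_i x i - rhs); rewrite mxE.
under eq_bigr => i _ do rewrite mxE Ex.
rewrite 2!big_split /= sumrN Ey -mulr_sumr; ring.
Qed.

(** The gluing of a face is a bijection of its edges onto those of the other face, and glued edges
    belong to the same class. *)
Lemma face_sum_edges (E : 'I_N * {set 'I_4}) (p : 'I_N * 'I_4) :
  let n i e : nat := connect (edge_glued (glue T)) E (i, e) in
  face_sum (n (face_glue p).1) (face_glue p).2 = face_sum (n p.1) p.2.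
Proof.
case: p => i w /=; rewrite /face_sum /face_glue /=.
set s := (glue T i w).2; set j := (glue T i w).1.
rewrite (reindex_inj (@perm_inj _ s)); apply: eq_big => [x|x x_w].
  by rewrite (inj_eq perm_inj).
congr nat_of_bool.
have Es : [set s w; s x] = s @: [set w; x] by rewrite imsetU !imset_set1.
have EsC : ~: [set s w; s x] = s @: (~: [set w; x]).
  apply/setP=> y; rewrite -[y](permKV s) Es inE !mem_imset ?inE //; exact: perm_inj.
have ij : edge_glued (glue T) (i, ~: [set w; x]) (j, ~: [set s w; s x]).
  by apply/existsP; exists w; rewrite !inE eqxx /= EsC.
have ji : edge_glued (glue T) (j, ~: [set s w; s x]) (i, ~: [set w; x]).
  apply/existsP; exists (s w); rewrite !inE eqxx /= glueK /= EsC -imset_comp.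
  rewrite (eq_imset (g := id)) ?imset_id ?eqxx // => y /=; exact: permK.
by apply/idP/idP => h; apply: connect_trans h (connect1 _).
Qed.

(** An arc enters through the face glued to the one by which its predecessor leaves. The curve [h],
    which governs the depths, stays fixed while the induction runs along [g]. *)
Lemma map_cycle_continues (g : seq (passage N)) (h : seq (passage N)) :
  path.cycle (continues T h) g ->
  [seq (tet x, frame x I42) | x <- rot 1 g] =
  [seq face_glue (tet x, frame x I43) | x <- g].
Proof.
case: g => [|x g]//=; rewrite rot1_cons.
suff: forall y, path (continues T h) y (rcons g x) ->
    [seq (tet x, frame x I42) | x <- rcons g x] =
    [seq face_glue (tet x, frame x I43) | x <- y :: g] by apply.
elim: g => [|z g IHg] y /=.
  rewrite andbT /continues /face_glue /=; case: (glue T _ _) => j s.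
  by case/and4P=> /eqP-> _ /eqP->.
move=> /andP[yz /IHg] /= ->; congr (_ :: _).
move: yz; rewrite /continues /face_glue /=; case: (glue T _ _) => j s.
by case/and4P=> /eqP-> _ /eqP->.
Qed.

(** The numbers e(i, _) of the cusp equation, with the signs of [cusp_coef] dropped. *)
Definition arcs_around (g : seq (passage N)) (i : 'I_N) (e : {set 'I_4}) : nat :=
  count (fun x => (tet x == i) && ([set frame x I40; frame x I41] == e)) g.

(** The edge around which an arc turns lies on exactly two faces, those crossed by the arc at its
    two ends; K(i, w) therefore counts the crossings of face w. *)
Lemma face_sum_arcs_around (g : seq (passage N)) (i : 'I_N) (w : 'I_4) :
  face_sum (arcs_around g i) w =
  (count_mem (i, w) [seq (tet x, frame x I42) | x <- g] +
   count_mem (i, w) [seq (tet x, frame x I43) | x <- g])%N.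
Proof.
elim: g => [|y g IHg]; first by rewrite /face_sum big1.
rewrite /face_sum big_split /= [X in (_ + X)%N]IHg addnACA; congr (_ + _)%N.
rewrite !xpair_eqE; case: (tet y == i) => /=; last by rewrite big1.
set f := frame y.
have Ef v : (v == f I40) || (v == f I41) = ~~ ((v == f I42) || (v == f I43)).
  rewrite -[v](permKV f) !(inj_eq perm_inj); apply/eqP.
  by move: (f^-1%g v); apply: forall_I4.
have fN : f I42 != f I43 by rewrite (inj_eq perm_inj).
have Ee x : ([set f I40; f I41] == ~: [set w; x]) =
            ([set f I42; f I43] == [set w; x]).
  rewrite -(inj_eq (@setC_inj _)) setCK; congr (_ == _).
  by apply/setP=> v; rewrite !inE Ef negbK.
have [?|wN2] := eqVneq (f I42) w; first subst w.
  rewrite (bigD1 (f I43)) /=; last by rewrite eq_sym.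
  rewrite Ee eqxx eq_sym (negPf fN) big1 // => x.
  case/andP=> _ x3; rewrite Ee; case: eqP => // /setP/(_ (f I43)).
  by rewrite !inE eqxx orbT eq_sym (negPf fN) /= eq_sym (negPf x3).
have [?|wN3] := eqVneq (f I43) w; first subst w.
  rewrite (bigD1 (f I42)) //= Ee setUC eqxx big1 // => x.
  case/andP=> _ x2; rewrite Ee; case: eqP => // /setP/(_ (f I42)).
  by rewrite !inE eqxx (negPf fN) /= eq_sym (negPf x2).
rewrite big1 // => x _; rewrite Ee; case: eqP => // /setP/(_ w).
by rewrite !inE eqxx eq_sym (negPf wN2) eq_sym (negPf wN3).
Qed.

(** On a closed curve, every exit through a face is an entrance through the face glued to it, and
    conversely. *)
Lemma face_sum_cusp (g : seq (passage N)) (p : 'I_N * 'I_4) :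
  path.cycle (continues T g) g ->
  face_sum (arcs_around g (face_glue p).1) (face_glue p).2 =
  face_sum (arcs_around g p.1) p.2.
Proof.
move=> /map_cycle_continues Eg.
have in_out r : count_mem (face_glue r) [seq (tet x, frame x I42) | x <- g] =
                count_mem r [seq (tet x, frame x I43) | x <- g].
  have /seq.permP-> : perm_eq [seq (tet x, frame x I42) | x <- g]
      [seq (tet x, frame x I42) | x <- rot 1 g].
    by rewrite map_rot perm_sym perm_rot.
  rewrite Eg !count_map; apply: eq_count => x /=.
  by rewrite (inj_eq (inv_inj face_glueK)).
rewrite !face_sum_arcs_around -!surjective_pairing in_out addnC; congr (_ + _)%N.
by rewrite -in_out face_glueK.
Qed.

Lemma sum_arcs_around (g : seq (passage N)) (i : 'I_N) (P : pred {set 'I_4}) :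
  (\sum_(e | P e) arcs_around g i e =
   count (fun x => (tet x == i) && P [set frame x I40; frame x I41]) g)%N.
Proof.
elim: g => [|x g IHg]; first by rewrite big1.
rewrite big_split /= IHg; congr (_ + _)%N; set e := [set _; _].
case: (tet x == i) => /=; last by rewrite big1.
case: (boolP (P e)) => Pe.
  rewrite (bigD1 e) //= eqxx big1 // => e' /andP[_].
  by rewrite eq_sym => /negPf->.
by rewrite big1 // => e' Pe'; case: eqP => // ee'; rewrite ee' Pe' in Pe.
Qed.

Lemma gluing_matrices_parity (q : 'I_N -> 'I_3) (A B : 'M[int]_N)
    (nu : 'cV[int]_N) :
  gluing_matrices T q A B nu ->
  forall j, exists y, (A *m B^T) j j = nu j 0 + 2 * y.
Proof.
case=> c [g] [E] [/and3P[g_cycle _ _] rowc rowE] j.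
have [->|j_c] := eqVneq j c.
  apply: (@gluing_row_parity _ _ _ _ _ 0 (arcs_around g) q _ _ rowc).
    by move=> p; apply: face_sum_cusp.
  move=> i l; rewrite sum_arcs_around /cusp_coef.
  (* A sign -1 differs by 2 from the 1 which [arcs_around] counts. *)
  elim: g {g_cycle rowc} => [|x g [y Ey]]; first by exists 0; rewrite big_nil.
  rewrite big_cons Ey /=; case: (_ && _); last by exists y.
  case: (odd_perm _); [exists (y - 1)|exists y]; rewrite ?expr1 ?expr0; lia.
have [_ row] := rowE j j_c.
apply: (@gluing_row_parity _ _ _ _ _ 1 _ q _ _ row).
  by move=> p; apply: (face_sum_edges (E j)).
move=> i l; exists 0; rewrite mulr0 addr0 /edge_coef -sum1_card; congr Posz.
rewrite big_mkcond [RHS]big_mkcond; apply: eq_bigr => e _; rewrite inE.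
by case: (edge_pair _ _); rewrite ?andbT ?andbF //; case: (connect _ _ _).
Qed.

End Parity.

(** * Parity of integral quadratic forms *)

Lemma dotE N (u v : 'cV[int]_N) : dot u v = \sum_i u i 0 * v i 0.
Proof. by rewrite /dot mxE; apply: eq_bigr => i _; rewrite mxE. Qed.

Lemma dotDl N (u v w : 'cV[int]_N) : dot (u + v) w = dot u w + dot v w.
Proof. by rewrite /dot linearD /= mulmxDl mxE. Qed.

Lemma dotDr N (u v w : 'cV[int]_N) : dot u (v + w) = dot u v + dot u w.
Proof. by rewrite /dot mulmxDr mxE. Qed.

Lemma dotZl N a (u v : 'cV[int]_N) : dot (a *: u) v = a * dot u v.
Proof. by rewrite /dot linearZ /= -scalemxAl mxE. Qed.

Lemma dotZr N a (u v : 'cV[int]_N) : dot u (a *: v) = a * dot u v.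
Proof. by rewrite /dot -scalemxAr mxE. Qed.

Lemma dot_mulmx N (M : 'M[int]_N) (u v : 'cV[int]_N) :
  dot (M *m u) v = dot u (M^T *m v).
Proof. by rewrite /dot trmx_mul mulmxA. Qed.

Lemma dot_sym N (M : 'M[int]_N) (u v : 'cV[int]_N) :
  M^T = M -> dot u (M *m v) = dot v (M *m u).
Proof.
move=> symM; rewrite -[in LHS]symM -dot_mulmx !dotE.
by apply: eq_bigr => i _; rewrite mulrC.
Qed.

Lemma int_mul_succ_even (x : int) : exists y, x * (x + 1) = 2 * y.
Proof.
have [q [->|->]] : exists q, x = 2 * q \/ x = 2 * q + 1.
- by exists (x %/ 2)%Z; lia.
- by exists (q * (2 * q + 1)); ring.
- by exists ((2 * q + 1) * (q + 1)); ring.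
Qed.

(** The off-diagonal terms are equal in pairs by symmetry; on the diagonal, [S j j * w j 0 ^+ 2] is
    congruent to [nu j 0 * w j 0], as an integer and its square have the same parity. *)
Lemma sym_form_parity N (S : 'M[int]_N) (nu w : 'cV[int]_N) :
  S^T = S -> (forall j, exists y, S j j = nu j 0 + 2 * y) ->
  exists h, dot w (S *m w) + dot w nu = 2 * h.
Proof.
move=> symS /fin_all_exists[y Ey].
have /fin_all_exists[x Ex] := fun j => int_mul_succ_even (w j 0).
have [||||h Eh] := @sum_involution _ _ (fun p : 'I_N * 'I_N => p.1 != p.2)
  (fun p => (p.2, p.1)) (fun p => w p.1 0 * S p.1 p.2 * w p.2 0).
- by move=> p; rewrite eq_sym.
- by case.
- by case=> a b; rewrite xpair_eqE /= eq_sym; apply: contraNN => /andP[].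
- by case=> a b _ /=; rewrite -[in LHS]symS mxE; ring.
exists (h + \sum_j (nu j 0 * x j + y j * (w j 0) ^+ 2)).
have -> : dot w (S *m w) = \sum_(p : 'I_N * 'I_N) w p.1 0 * S p.1 p.2 * w p.2 0.
  rewrite dotE -(pair_bigA _ (fun a b => w a 0 * S a b * w b 0)) /=.
  by apply: eq_bigr => a _; rewrite mxE mulr_sumr; apply: eq_bigr => b _; rewrite mulrA.
rewrite (bigID (fun p : 'I_N * 'I_N => p.1 != p.2)) /= Eh.
rewrite (eq_bigl (fun p : 'I_N * 'I_N => true && (p.1 == p.2))); last first.
  by move=> p; rewrite negbK.
rewrite -(pair_big_dep xpredT (fun a b => a == b) (fun a b => w a 0 * S a b * w b 0)) /=.
rewrite mulrDr mulr_natl -addrA; congr (_ + _); rewrite dotE -big_split mulr_sumr /=.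
apply: eq_bigr => a _; rewrite (big_pred1 a) => [|b]; last by rewrite eq_sym.
rewrite Ey (_ : 2 * (nu a 0 * x a + y a * w a 0 ^+ 2) = nu a 0 * (2 * x a) + 2 * y a * w a 0 ^+ 2).
  by rewrite -Ex; ring.
by ring.
Qed.

Section HalfSymplectic.
Variables (N : nat) (A B : 'M[int]_N) (nu : 'cV[int]_N).
Hypotheses (symAB : (A *m B^T) = (A *m B^T)^T) (B_unit : B \in unitmx).
Let Q := invmx B *m A.

(** [Q] is congruent to the symmetric matrix A B^T: it equals B^-1 (A B^T) B^-T. *)
Lemma sym_invmx_mul : Q^T = Q.
Proof.
have BT_unit : B^T \in unitmx by rewrite unitmx_tr.
have -> : Q = invmx B *m (A *m B^T) *m invmx B^T by rewrite mulmxA mulmxK.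
by rewrite 2!trmx_mul -symAB !trmx_inv trmxK mulmxA.
Qed.

(** The unimodular substitution m = B^T w turns the form into w.(A B^T w) + w.nu. The even number
    obtained is the exponent of zeta^(1/2) in the weight. *)
Lemma invmx_mul_parity (m : 'cV[int]_N) :
  (forall j, exists y, (A *m B^T) j j = nu j 0 + 2 * y) ->
  exists h, dot m (Q *m m) + dot m (invmx B *m nu) = 2 * h.
Proof.
move=> parity; have [w ->] : exists w, m = B^T *m w.
  by exists ((invmx B)^T *m m); rewrite mulmxA -trmx_mul mulVmx // trmx1 mul1mx.
have [h Eh] := sym_form_parity w (esym symAB) parity; exists h.
by rewrite -Eh !dot_mulmx !trmxK /Q !mulmxA mulmxV // !mul1mx.
Qed.

End HalfSymplectic.

(** * Functions of the twist *)

Lemma sum_prim_root_exp (L : fieldType) (k mu : nat) (w : L) :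
  k.-primitive_root w ->
  \sum_(c < k) w ^+ (c * mu) = if (k %| mu)%N then k%:R else 0.
Proof.
move=> w_prim; under eq_bigr => c _ do rewrite mulnC exprM.
case: ifPn => [/dvdnP[q ->]|k_mu].
  under eq_bigr => c _ do rewrite mulnC exprM (prim_expr_order w_prim) !expr1n.
  by rewrite big_const_ord iter_addr_0.
have wmu1 : w ^+ mu - 1 != 0.
  by rewrite subr_eq0; apply: contraNneq k_mu => /eqP; rewrite (prim_order_dvd w_prim).
apply: (mulfI wmu1); rewrite -subrX1 -exprM mulnC exprM.
by rewrite (prim_expr_order w_prim) expr1n subrr mulr0.
Qed.

Section Twist.
Variables (L : numFieldType) (F : divringClosed L) (N k : nat).
Variables (w : L) (theta : 'I_N -> L).
Hypotheses (w_prim : k.+1.-primitive_root w) (wF : w \in F).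
Hypotheses (theta_neq0 : forall i, theta i != 0)
           (thetaXF : forall i, theta i ^+ k.+1 \in F).

(** The modulus is written k+1 so that the entries carry the addition of Z/(k+1)Z; the twists then
    form a group. *)
Let tw := {ffun 'I_N -> 'I_k.+1}.

Definition twist (c : tw) (i : 'I_N) : L := theta i / w ^+ c i.

(* When the conjugates of theta over F are the [twist c], these are the functions
   mapping a twist to the corresponding conjugate of an element of F(theta). *)
Definition twistable (h : tw -> L) : Prop :=
  exists2 s : seq (L * {ffun 'I_N -> nat}), all (fun x => x.1 \in F) s &
    forall c, h c = \sum_(x <- s) x.1 * \prod_i twist c i ^+ x.2 i.

Let w_neq0 : w != 0.
Proof.
apply: contra_eq_neq (prim_expr_order w_prim) => ->.
by rewrite expr0n /= eq_sym oner_neq0.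
Qed.

Lemma twist_neq0 c i : twist c i != 0.
Proof. by rewrite mulf_neq0 ?invr_neq0 ?expf_neq0. Qed.

Lemma twist_exp c i : twist c i ^+ k.+1 = theta i ^+ k.+1.
Proof.
by rewrite expr_div_n -exprM mulnC exprM (prim_expr_order w_prim) expr1n divr1.
Qed.

Lemma twist0 : twist 0 =1 theta.
Proof. by move=> i; rewrite /twist ffunE expr0 divr1. Qed.

Lemma twistD c d i : twist (c + d) i = twist c i / w ^+ d i.
Proof.
by rewrite /twist ffunE /= prim_expr_mod // exprD invfM mulrA.
Qed.

Lemma eq_twistable h h' : h =1 h' -> twistable h -> twistable h'.
Proof. by move=> hh' [s sF E]; exists s => // c; rewrite -hh'. Qed.

Lemma twistable_cst a : a \in F -> twistable (fun=> a).
Proof.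
move=> aF; exists [:: (a, [ffun=> 0%N])]; rewrite /= ?aF // => c.
by rewrite big_seq1 /= big1 ?mulr1 // => i _; rewrite ffunE expr0.
Qed.

Lemma twistable_var i : twistable (fun c => twist c i).
Proof.
exists [:: (1, [ffun j : 'I_N => (i == j) : nat])]; rewrite /= ?rpred1 // => c.
rewrite big_seq1 mul1r (bigD1 i) //= ffunE eqxx big1 ?mulr1 // => j.
by rewrite ffunE eq_sym => /negPf->.
Qed.

Lemma twistableD g h : twistable g -> twistable h -> twistable (fun c => g c + h c).
Proof.
move=> [s sF Es] [t tF Et]; exists (s ++ t); first by rewrite all_cat sF.
by move=> c; rewrite Es Et big_cat.
Qed.

Lemma twistableM g h : twistable g -> twistable h -> twistable (fun c => g c * h c).
Proof.
move=> [s sF Es] [t tF Et].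
pose mul (x y : L * {ffun 'I_N -> nat}) := (x.1 * y.1, [ffun i => (x.2 i + y.2 i)%N]).
exists [seq mul x y | x <- s, y <- t].
  apply/all_allpairsP => x y xs yt /=.
  by rewrite rpredM ?(allP sF _ xs) ?(allP tF _ yt).
move=> c; rewrite Es Et big_allpairs_dep mulr_suml; apply: eq_bigr => x _.
rewrite mulr_sumr; apply: eq_bigr => y _ /=.
rewrite mulrACA -big_split; congr (_ * _); apply: eq_bigr => i _.
by rewrite ffunE exprD.
Qed.

Lemma twistable_sum I (r : seq I) (P : pred I) (h : I -> tw -> L) :
  (forall i, P i -> twistable (h i)) ->
  twistable (fun c => \sum_(i <- r | P i) h i c).
Proof.
move=> hD; elim: r => [|i r IHr].
  by apply: eq_twistable (twistable_cst (rpred0 F)) => c; rewrite big_nil.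
case Pi: (P i); last by apply: eq_twistable IHr => c; rewrite big_cons Pi.
apply: eq_twistable (twistableD (hD i Pi) IHr) => c; by rewrite big_cons Pi.
Qed.

Lemma twistable_prod I (r : seq I) (P : pred I) (h : I -> tw -> L) :
  (forall i, P i -> twistable (h i)) ->
  twistable (fun c => \prod_(i <- r | P i) h i c).
Proof.
move=> hD; elim: r => [|i r IHr].
  by apply: eq_twistable (twistable_cst (rpred1 F)) => c; rewrite big_nil.
case Pi: (P i); last by apply: eq_twistable IHr => c; rewrite big_cons Pi.
apply: eq_twistable (twistableM (hD i Pi) IHr) => c; by rewrite big_cons Pi.
Qed.

Lemma twistableX h n : twistable h -> twistable (fun c => h c ^+ n).
Proof.
move=> hD; apply: eq_twistable (twistable_prod (index_enum 'I_n) (P := predT) (fun _ _ => hD)) => c.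
by rewrite prodr_const card_ord.
Qed.

(** A shift multiplies each variable by a power of [w], which lies in [F] and is absorbed by the
    coefficients. *)
Lemma twistable_shift d h : twistable h -> twistable (fun c => h (c + d)).
Proof.
case=> s sF Es.
exists [seq (x.1 * \prod_i (w ^+ d i)^-1 ^+ (x.2 : {ffun 'I_N -> nat}) i, x.2) | x <- s].
  rewrite all_map; apply: sub_all sF => x /= xF; rewrite rpredM // rpred_prod // => i _.
  by rewrite rpredX // rpredVr // rpredX.
move=> c; rewrite Es big_map; apply: eq_bigr => x _ /=.
rewrite -mulrA -big_split /=; congr (_ * _); apply: eq_bigr => i _.
by rewrite twistD exprMn mulrC.
Qed.

(* Averaging over the twists kills the monomials which are not powers of the
   theta i ^+ k.+1. *)
Lemma twistable_const h a : twistable h -> (forall c, h c = a) -> a \in F.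
Proof.
move=> [s sF Es] ha.
have tw_neq0 : #|{: tw}|%:R != 0 :> L.
  by rewrite pnatr_eq0 -lt0n; apply/card_gt0P; exists 0.
rewrite -[a](mulfK tw_neq0) mulr_natr -sumr_const.
rewrite (eq_bigr (fun c => \sum_(x <- s) x.1 * \prod_i twist c i ^+ x.2 i)); last first.
  by move=> c _; rewrite -Es ha.
rewrite rpred_div ?rpred_nat // exchange_big /= big_seq rpred_sum // => x xs.
rewrite -mulr_sumr; apply: rpredM; first exact: (allP sF).
(* The sum over all twists of a monomial factors into one sum of roots of unity per variable. *)
rewrite -(bigA_distr_bigA (fun i (j : 'I_k.+1) => (theta i / w ^+ j) ^+ x.2 i)).
apply: rpred_prod => i _.
under eq_bigr => j _ do rewrite expr_div_n -exprM.
rewrite -mulr_sumr; under eq_bigr => j _ do rewrite -exprVn.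
rewrite sum_prim_root_exp //; last first.
  (* Twists divide by powers of [w]; its inverse is again primitive, being the power with exponent
     k, prime to k+1. *)
  have wV : w^-1 = w ^+ k.
    by apply: (mulfI w_neq0); rewrite mulfV // -exprS (prim_expr_order w_prim).
  by rewrite wV prim_root_exp_coprime // coprimenS.
case: ifP => [/dvdnP[q ->]|]; last by rewrite mulr0 rpred0.
apply: rpredM; last exact: rpred_nat.
by rewrite mulnC exprM; apply: rpredX; apply: thetaXF.
Qed.

(** The product of all shifts of [h] is a norm: it is invariant, hence a nonzero constant of [F].
    The inverse of [h] is the product of the other shifts divided by this norm. *)
Lemma twistableV h :
  twistable h -> (forall c, h c != 0) -> twistable (fun c => (h c)^-1).
Proof.
move=> hD h_neq0; pose n (c : tw) := \prod_(d : tw) h (c + d).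
have n_cst c : n c = n 0.
  rewrite /n [RHS](reindex_inj (addrI c)).
  by apply: eq_bigr => d _; rewrite add0r.
have nF : n 0 \in F.
  by apply: twistable_const n_cst; apply: twistable_prod => d _; apply: twistable_shift.
have n_neq0 : n 0 != 0 by apply/prodf_neq0.
have := twistableM (twistable_cst (rpredVr nF)) (twistable_prod (index_enum tw)
  (P := predC1 0) (fun d _ => twistable_shift d hD)).
apply: eq_twistable => c; apply: (mulfI (h_neq0 c)).
rewrite mulrCA [X in _ * X](_ : _ = n c); first by rewrite n_cst mulVf ?mulfV.
by rewrite /n [RHS](bigD1 (0 : tw)) //= addr0.
Qed.

End Twist.

(** * The weights *)

Section Expi.
Variable R : realType.

Lemma expiD (s t : R) : expi (s + t) = expi s * expi t.
Proof. by rewrite /expi cosD sinD; apply/eqP; rewrite eq_complex /= addrC !eqxx addrC eqxx. Qed.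

Lemma expi0 : expi (0 : R) = 1.
Proof. by rewrite /expi cos0 sin0. Qed.

Lemma expi_pi : expi (pi : R) = -1.
Proof. by rewrite /expi cospi sinpi; apply/eqP; rewrite eq_complex /= oppr0 !eqxx. Qed.

Lemma expiMn (t : R) n : expi (t *+ n) = expi t ^+ n.
Proof. by elim: n => [|n IHn]; rewrite ?expi0 // mulrSr expiD IHn exprSr. Qed.

Lemma expi_neq0 (t : R) : expi t != 0.
Proof.
apply: contra_neq (oner_neq0 R[i]) => t0.
by rewrite -expi0 -[0](subrr t) expiD t0 mul0r.
Qed.

Lemma expiN (t : R) : expi (- t) = (expi t)^-1.
Proof.
by apply: (mulfI (expi_neq0 t)); rewrite mulfV ?expi_neq0 // -expiD subrr expi0.
Qed.

Lemma expiMz (t : R) (n : int) : expi (t * n%:~R) = expi t ^ n.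
Proof.
case: n => n; first by rewrite mulr_natr expiMn.
by rewrite NegzE mulrNz mulrN expiN mulr_natr expiMn.
Qed.

Lemma expi_piV_exp k : expi (pi / k.+1%:R) ^+ k.+1 = -1 :> R[i].
Proof. by rewrite -expiMn -[pi / _ *+ _]mulr_natr divfK ?pnatr_eq0 // expi_pi. Qed.

Lemma expi_piV_sqr k : expi (pi / k.+1%:R) ^+ 2 = zeta R k.+1.
Proof. by rewrite -expiMn /zeta -[pi / _ *+ _]mulr_natl mulrA. Qed.

(** If the order were j < k+1, the number exp(pi i j/(k+1)) would be 1 or -1, whereas its imaginary
    part is positive. *)
Lemma zeta_prim k : k.+1.-primitive_root (zeta R k.+1).
Proof.
have zetaX1 : zeta R k.+1 ^+ k.+1 = 1.
  by rewrite -expi_piV_sqr exprAC expi_piV_exp sqrrN expr1n.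
have [j j_prim j_k] := prim_order_exists (ltn0Sn k) zetaX1.
suff jk : (k.+1 <= j)%N.
  have /eqP Ej : j == k.+1 by rewrite eqn_leq jk dvdn_leq.
  by rewrite Ej in j_prim.
rewrite leqNgt; apply/negP => j_lt.
have : expi (pi / k.+1%:R *+ j) ^+ 2 == 1 :> R[i].
  by rewrite expiMn exprAC expi_piV_sqr (prim_expr_order j_prim).
have : 0 < sin (pi / k.+1%:R *+ j) :> R.
  apply: sin_gt0_pi; rewrite pmulrn_lgt0 ?(prim_order_gt0 j_prim) //.
  rewrite divr_gt0 ?pi_gt0 ?ltr0n //= -[pi / _ *+ _]mulr_natr mulrAC ltr_pdivrMr ?ltr0n //.
  by rewrite ltr_pM2l ?pi_gt0 ?ltr_nat.
by rewrite sqrf_eq1 /expi !eq_complex /= oppr0 => /gt_eqF->; rewrite !andbF.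
Qed.

End Expi.

Lemma qpochD (K : fieldType) (x q : K) m n :
  qpoch x q (m + n) = qpoch x q m * qpoch (q ^+ m * x) q n.
Proof.
rewrite /qpoch big_split_ord /=; congr (_ * _); apply: eq_bigr => r _.
by rewrite exprD -mulrA mulrCA mulrA.
Qed.

(** This is the factorization of X^k - 1 into the factors X - q^r, evaluated at 1/x and multiplied
    by x^k. *)
Lemma qpoch_prim (K : fieldType) (x q : K) k :
  k.-primitive_root q -> qpoch x q k = 1 - x ^+ k.
Proof.
move=> q_prim; have [->|x_neq0] := eqVneq x 0.
  rewrite expr0n gtn_eqF ?(prim_order_gt0 q_prim) // subr0.
  by apply: big1 => r _; rewrite mulr0 subr0.
have := congr1 (fun p => x ^+ k * p.[x^-1]) (factor_Xn_sub_1 q_prim).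
rewrite !hornerE mulrBr mulr1 -exprMn mulfV // expr1n => <-.
rewrite big_mkord horner_prod -[in x ^+ k](card_ord k) -prodr_const -big_split.
by apply: eq_bigr => r _; rewrite !hornerE /= mulrBr mulfV // mulrC.
Qed.

Lemma qpoch_prim_mul (K : fieldType) (x q : K) k n :
  k.-primitive_root q -> qpoch x q (k * n) = (1 - x ^+ k) ^+ n.
Proof.
move=> q_prim; elim: n => [|n IHn]; first by rewrite muln0 /qpoch big_ord0.
rewrite mulnS qpochD (prim_expr_order q_prim) mul1r IHn qpoch_prim //.
by rewrite exprS.
Qed.

Lemma prod_exprz (K : fieldType) (I : finType) (x : K) (n : I -> int) :
  x != 0 -> \prod_i x ^ n i = x ^ (\sum_i n i).
Proof.
move=> x_neq0; elim/big_rec2: _ => [|i y m _ ->]; first by rewrite expr0z.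
by rewrite expfzDr.
Qed.

Lemma prodXz (K : fieldType) (I : finType) (x : I -> K) (n : int) :
  \prod_i x i ^ n = (\prod_i x i) ^ n.
Proof.
by elim/big_rec2: _ => [|i y m _ ->]; rewrite ?exp1rz ?expfzMl.
Qed.

Lemma exprz_2mul (K : fieldType) (x : K) (n : int) : x ^ (2 * n) = (x ^+ 2) ^ n.
Proof. by rewrite -exprz_exp. Qed.

Lemma expN1D (K : fieldType) (m n : int) :
  (-1) ^ (m + n) = (-1) ^ m * (-1) ^ n :> K.
Proof. by rewrite expfzDr // oppr_eq0 oner_neq0. Qed.

Section Weight.
Variables (R : realType) (N k : nat) (A B : 'M[int]_N) (nu : 'cV[int]_N).
Variables (z : 'I_N -> R[i]).
Hypotheses (symAB : (A *m B^T) = (A *m B^T)^T) (B_unit : B \in unitmx).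
Hypotheses (z_neq0 : forall i, z i != 0) (z_neq1 : forall i, z i != 1).
Hypothesis z_gluing : forall j,
  \prod_i (z i ^ A j i * (1 - (z i)^-1) ^ B j i) = (-1) ^ nu j 0.

Let Q := invmx B *m A.
Let b := invmx B *m nu.
Let zet := zeta R k.+1.
Let e := expi (pi / k.+1%:R) : R[i].
Let vec (m : 'I_N -> nat) : 'cV[int]_N := \col_i (m i)%:Z.
Let a (theta : 'I_N -> R[i]) m := weight k.+1 A B nu theta m.

Let e_neq0 : e != 0. Proof. exact: expi_neq0. Qed.
Let zet_neq0 : zet != 0. Proof. exact: expi_neq0. Qed.

Lemma weightE theta m : a theta m =
  (-1) ^ dot (vec m) (Q *m vec m) *
  e ^ (dot (vec m) (Q *m vec m) + dot (vec m) b) *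
  \prod_i (theta i ^ (- (Q *m vec m) i 0) / qpoch (zet / theta i) zet (m i)).
Proof.
rewrite /a /weight expiN expiMz expi_pi; congr (_ * _ * _).
by rewrite invr_expz -exprz_inv invrN1.
Qed.

(** By symmetry of Q the quadratic form has the cross term 2s with s = c.Qm. It contributes zeta^s,
    which is also what the powers of the twisted theta contribute, and no sign. The Pochhammer
    symbols combine by [qpochD]. *)
Lemma weight_add theta (m c : 'I_N -> nat) : (forall i, theta i != 0) ->
  a (fun i => theta i / zet ^+ c i) m * a theta c = a theta (fun i => m i + c i)%N.
Proof.
move=> theta_neq0; rewrite !weightE.
have -> : vec (fun i => m i + c i)%N = vec m + vec c.
  by apply/colP => i; rewrite !mxE PoszD.
set M := vec m; set C := vec c; pose s := dot C (Q *m M).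
rewrite mulmxDr !dotDl !dotDr (dot_sym M C (sym_invmx_mul symAB B_unit)) -/s.
rewrite mulrACA -big_split /=.
have -> : dot M (Q *m M) + s + (s + dot C (Q *m C)) + (dot M b + dot C b) =
  (dot M (Q *m M) + dot M b) + (dot C (Q *m C) + dot C b) + 2 * s by ring.
have -> : dot M (Q *m M) + s + (s + dot C (Q *m C)) =
  dot M (Q *m M) + dot C (Q *m C) + 2 * s by ring.
have e2 : e ^+ 2 = zet := expi_piV_sqr R k.
move: (e) (zet) e_neq0 zet_neq0 e2 => r q r_neq0 q_neq0 r2.
rewrite !(expfzDr _ _ r_neq0) !expN1D !exprz_2mul sqrrN expr1n exp1rz mulr1 r2.
rewrite [X in _ * X = _](_ : _ = q ^ s * \prod_i
    (theta i ^ (- (Q *m M + Q *m C) i 0) / qpoch (q / theta i) q (m i + c i))).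
  by rewrite [X in X * _ = _]mulrACA !mulrA.
rewrite /s dotE -prod_exprz // -big_split; apply: eq_bigr => i _ /=.
rewrite [(Q *m M + _) i 0]mxE opprD expfzDr // addnC qpochD.
rewrite [C i 0]mxE expfzMl exprz_inv opprK exprnP exprz_exp.
rewrite (_ : q / (theta i / q ^ c i) = q ^ c i * (q / theta i)); last first.
  by rewrite invf_div mulrCA.
move: (qpoch _ _ (c i)) (qpoch _ _ (m i)) => x y.
rewrite invfM.
move: (x^-1) (y^-1) (theta i ^ _) (theta i ^ _) (q ^ _) => x' y' u v t.
ring.
Qed.

(** Multiply the gluing equations together, the j-th one raised to the power [v j 0]. *)
Lemma gluing_comb (v : 'cV[int]_N) :
  \prod_i (z i ^ (A^T *m v) i 0 * (1 - (z i)^-1) ^ (B^T *m v) i 0) = (-1) ^ dot v nu.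
Proof.
have zV_neq0 i : 1 - (z i)^-1 != 0.
  by rewrite subr_eq0 eq_sym invr_eq1.
rewrite dotE -prod_exprz ?oppr_eq0 ?oner_neq0 //.
under [RHS]eq_bigr => j _ do rewrite mulrC -exprz_exp -z_gluing -prodXz.
rewrite exchange_big; apply: eq_bigr => i _ /=; rewrite !mxE -!prod_exprz // -big_split.
by apply: eq_bigr => j _; rewrite !mxE expfzMl !exprz_exp.
Qed.

(** Since theta_i^(k+1) = z_i, the product over i becomes the inverse of the left-hand side of
    [gluing_comb] for v = B^-T n. The remaining factors give the sign (-1)^(v.nu), because
    (k+1)(k+2) is even. *)
Lemma weight_period theta n : (forall i, theta i ^+ k.+1 = z i) ->
  a theta (fun i => k.+1 * n i)%N = 1.
Proof.
move=> thetaX; rewrite weightE.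
have -> : vec (fun i => k.+1 * n i)%N = k.+1%:Z *: vec n.
  by apply/colP => i; rewrite !mxE PoszM.
set V := vec n; rewrite -scalemxAr !dotZl dotZr; set d := dot V _.
pose v := (invmx B)^T *m V.
have Ev : dot V b = dot v nu by rewrite dot_mulmx trmxK.
have EA : A^T *m v = Q *m V.
  by rewrite mulmxA -trmx_mul sym_invmx_mul.
have EB : B^T *m v = V.
  by rewrite mulmxA -trmx_mul mulVmx // trmx1 mul1mx.
rewrite -(mulrDr k.+1%:Z) -(exprz_exp e) -exprnP expi_piV_exp -expN1D.
have [y Ey] := int_mul_succ_even k.+1%:Z.
have -> : k.+1%:Z * (k.+1%:Z * d) + (k.+1%:Z * d + dot V b) = 2 * (y * d) + dot v nu.
  rewrite Ev (_ : _ + _ = k.+1%:Z * (k.+1%:Z + 1) * d + dot v nu); last by ring.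
  by rewrite Ey; ring.
rewrite expN1D exprz_2mul sqrrN expr1n exp1rz mul1r.
rewrite -gluing_comb -big_split big1 // => i _ /=; rewrite EA EB.
rewrite qpoch_prim_mul; last exact: zeta_prim.
rewrite expr_div_n (prim_expr_order (zeta_prim R k)) thetaX mul1r.
rewrite [V i 0]mxE [(k.+1%:Z *: (Q *m V) : 'cV_N) i 0]mxE -mulrN -exprz_exp.
rewrite -!exprnP thetaX -invr_expz.
have zV_neq0 : 1 - (z i)^-1 != 0 by rewrite subr_eq0 eq_sym invr_eq1.
by rewrite mulrACA !mulfV ?mul1r // ?expfz_neq0 ?expf_neq0.
Qed.

End Weight.

(** * The integrand *)

(** A fixed-point free involution exists only on a set of even cardinality, as seen by summing 1
    over the set. *)
Lemma wick_odd (K : fieldType) (N d : nat) (H : 'M[K]_N) (t : d.-tuple 'I_N) :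
  odd d -> wick H t = 0.
Proof.
move=> d_odd; apply: big1 => s /forallP s_pair; exfalso.
have [//|a _|a _|//|y] := @sum_involution _ _ predT s (fun=> 1%N).
- by have /andP[_ /eqP] := s_pair a.
- by have /andP[] := s_pair a.
rewrite sum1_card card_ord => Ed; move: d_odd.
by rewrite Ed mulr2n oddD addbb.
Qed.

Lemma size_mon_indices N (mu : multinom N) : size (mon_indices mu) = mdeg mu.
Proof.
rewrite /mon_indices size_flatten /shape -map_comp sumnE big_map mdegE big_enum.
by apply: eq_bigr => i _ /=; rewrite size_nseq.
Qed.

Lemma polyOver_bernoulli (K : numFieldType) (F : divringClosed K) n :
  bernoulli K n \is a polyOver F.
Proof.
have H m : all (fun p => p \is a polyOver F) (bernoulli_seq K m).
  elim: m => //= m IHm; rewrite all_rcons IHm andbT rpredB ?rpredX ?polyOverX //.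
  apply: polyOverZ; first by rewrite rpredVr ?rpred_nat.
  apply: rpred_sum => i _; apply: rpredMn.
  have [/(all_nthP 0 IHm)//|/(nth_default 0)->] := ltnP i (size (bernoulli_seq K m)).
  exact: rpred0.
have := H n.+1; rewrite /bernoulli => /(all_nthP 0); apply.
by rewrite size_bernoulli_seq.
Qed.

Section Li.
Variables (K : numFieldType) (F : divringClosed K).

Let Lr (l : nat) : {poly K} * {poly K} := iter l (@euler K) ('X, 1 - 'X).

Lemma polyOver_Li l : (Lr l).1 \is a polyOver F /\ (Lr l).2 \is a polyOver F.
Proof.
elim: l => [|l [IH1 IH2]] /=; first by rewrite polyOverX rpredB ?polyOverX ?rpred1.
split; last exact: rpredX.
by rewrite rpredM ?polyOverX // rpredB ?rpredM ?polyOver_deriv.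
Qed.

(** Each application of [euler] squares the denominator, which thus remains a power of 1 - y. *)
Lemma Li_den_neq0 l (y : K) : y != 1 -> (Lr l).2.[y] != 0.
Proof.
move=> y_neq1; elim: l => [|l IHl] /=; first by rewrite !hornerE subr_eq0 eq_sym.
by rewrite horner_exp expf_neq0.
Qed.

End Li.

Section Families.
Variables (R : realType) (F : divringClosed R[i]) (N k : nat).
Variable theta : 'I_N -> R[i].
Hypotheses (zetaF : zeta R k.+1 \in F) (theta_neq0 : forall i, theta i != 0)
           (thetaXF : forall i, theta i ^+ k.+1 \in F)
           (thetaX_neq1 : forall i, theta i ^+ k.+1 != 1).

Let tw := {ffun 'I_N -> 'I_k.+1}.
Let zet := zeta R k.+1.
Let zet_prim : k.+1.-primitive_root zet := zeta_prim R k.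
Let D (h : tw -> R[i]) := twistable F zet theta h.
Let D_cst x : x \in F -> D (fun=> x). Proof. exact: twistable_cst. Qed.
Let th (c : tw) := twist zet theta c.

(** Besides twistability, this records that the coefficient of hbar^(p/2) contains only monomials in
    x of degree congruent to p modulo 2; Gaussian integration then kills the odd p. *)
Definition graded (p : nat) (P : tw -> mpoly N R[i]) : Prop :=
  forall mu, D (fun c => mcoeff mu (P c)) /\
    (odd (mdeg mu) != odd p -> forall c, mcoeff mu (P c) = 0).

Definition hgraded (a : tw -> hseries (mpoly N R[i])) : Prop :=
  forall p, graded p (fun c => a c p).

Lemma eq_graded p P Q : P =1 Q -> graded p P -> graded p Q.
Proof.
move=> PQ Pg mu; have [PD P0] := Pg mu; split=> [|mu_p c]; last by rewrite -PQ P0.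
by apply: eq_twistable PD => c; rewrite PQ.
Qed.

Lemma graded0 p : graded p (fun=> 0).
Proof.
move=> mu; split=> [|_ c]; last by rewrite mcoeff0.
by apply: eq_twistable (D_cst (rpred0 F)) => c; rewrite mcoeff0.
Qed.

Lemma graded_odd p q P : odd p = odd q -> graded p P -> graded q P.
Proof. by move=> pq Pg mu; rewrite -pq. Qed.

Lemma gradedD p P Q : graded p P -> graded p Q -> graded p (fun c => P c + Q c).
Proof.
move=> Pg Qg mu; have [PD P0] := Pg mu; have [QD Q0] := Qg mu.
split=> [|mu_p c]; last by rewrite mcoeffD P0 ?Q0 ?addr0.
by apply: eq_twistable (twistableD PD QD) => c; rewrite mcoeffD.
Qed.

Lemma graded_sum p I (r : seq I) (P : pred I) (a : I -> tw -> mpoly N R[i]) :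
  (forall i, P i -> graded p (a i)) -> graded p (fun c => \sum_(i <- r | P i) a i c).
Proof.
move=> ag; elim: r => [|i r IHr].
  by apply: eq_graded (graded0 p) => c; rewrite big_nil.
case Pi: (P i); last by apply: eq_graded IHr => c; rewrite big_cons Pi.
by apply: eq_graded (gradedD (ag i Pi) IHr) => c; rewrite big_cons Pi.
Qed.

Lemma gradedM p q P Q :
  graded p P -> graded q Q -> graded (p + q) (fun c => P c * Q c).
Proof.
move=> Pg Qg mu; split=> [|mu_pq c].
  apply: eq_twistable (_ : twistable _ _ _ (fun c => \sum_(_ | _) _)) => [c|].
    by rewrite mcoeffM.
  by apply: twistable_sum => m _; apply: twistableM; [case: (Pg m.1)|case: (Qg m.2)].
rewrite mcoeffM big1 // => m /eqP Emu.
have [_ P0] := Pg m.1; have [_ Q0] := Qg m.2.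
case: (boolP (odd (mdeg m.1) != odd p)) => [/P0->|/negPn/eqP m1_p]; first by rewrite mul0r.
rewrite Q0 ?mulr0 //; apply: contraNneq mu_pq => m2_q.
by rewrite Emu mdegD !oddD m1_p m2_q.
Qed.

Lemma graded1 : graded 0 (fun=> 1).
Proof.
move=> mu; split=> [|mu_odd c].
  by apply: eq_twistable (D_cst (rpred_nat F (mu == mnm0))) => c; rewrite mcoeff1.
rewrite mcoeff1; have [mu0|] := eqVneq mu mnm0; last by [].
by rewrite mu0 mdeg0 in mu_odd.
Qed.

Lemma gradedZ p h P : D h -> graded p P -> graded p (fun c => h c *: P c).
Proof.
move=> hD Pg mu; have [PD P0] := Pg mu.
split=> [|mu_p c]; last by rewrite mcoeffZ P0 ?mulr0.
by apply: eq_twistable (twistableM hD PD) => c; rewrite mcoeffZ.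
Qed.

Lemma graded_xvar i : graded 1 (fun=> xvar R i).
Proof.
move=> mu; rewrite /xvar; split=> [|mu_p c].
  by apply: eq_twistable (D_cst (rpred_nat F (mnm1 i == mu))) => c; rewrite mcoeffX.
rewrite mcoeffX; have [Emu|] := eqVneq (mnm1 i) mu; last by [].
by rewrite -Emu mdeg1 in mu_p.
Qed.

Lemma gradedX p P n : graded p P -> graded (p * n) (fun c => P c ^+ n).
Proof.
move=> Pg; elim: n => [|n IHn]; first by rewrite muln0; apply: graded1.
by rewrite mulnS; apply: eq_graded (gradedM Pg IHn) => c; rewrite exprS.
Qed.

Lemma hgraded_one : hgraded (fun=> @hs_one _).
Proof.
case=> [|p]; first exact: graded1.
exact: graded0.
Qed.

Lemma hgraded_mul a b : hgraded a -> hgraded b -> hgraded (fun c => hs_mul (a c) (b c)).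
Proof.
move=> ag bg p; apply: graded_sum => r _.
by apply: graded_odd (gradedM (ag r) (bg (p - r)%N)); rewrite subnKC // -ltnS.
Qed.

Lemma hgraded_exp a : hgraded a -> hgraded (fun c => hs_exp (a c)).
Proof.
move=> ag p; apply: graded_sum => r _; apply: gradedZ.
  by apply: twistable_cst; rewrite rpredVr ?rpred_nat.
have ig : hgraded (fun c => iter r (hs_mul (a c)) (@hs_one _)).
  by elim: (val r) => [|n IHn] /=; [apply: hgraded_one|apply: hgraded_mul].
exact: ig.
Qed.

Lemma hgraded_prod (r : seq 'I_N) (a : 'I_N -> tw -> hseries (mpoly N R[i])) :
  (forall i, hgraded (a i)) ->
  hgraded (fun c => \big[@hs_mul _/@hs_one _]_(i <- r) a i c).
Proof.
move=> ag; elim: r => [|i r IHr] p.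
  by apply: eq_graded (hgraded_one p) => c; rewrite big_nil.
by apply: eq_graded (hgraded_mul (ag i) IHr p) => c; rewrite big_cons.
Qed.

Lemma twistable_horner (p : {poly R[i]}) h :
  p \is a polyOver F -> D h -> D (fun c => p.[h c]).
Proof.
move=> /polyOverP pF hD.
apply: eq_twistable (_ : twistable _ _ _ (fun c => \sum_(i < size p) p`_i * h c ^+ i)) => [c|].
  by rewrite horner_coef.
by apply: twistable_sum => i _; apply: twistableM (twistableX _ hD); apply: twistable_cst.
Qed.

Let twV h := @twistableV _ F N k zet theta zet_prim zetaF thetaXF h.

Lemma theta_twist_neq0 c i : th c i != 0.
Proof. exact: twist_neq0. Qed.

(** The (k+1)-st power of the quotient is the inverse of theta_i^(k+1), which is not 1. Both the
    poles of the polylogarithms and the zeros of the Pochhammer symbols are thereby avoided. *)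
Lemma zeta_div_twist_neq1 m c i : zet ^+ m / th c i != 1.
Proof.
apply: contra_neq (thetaX_neq1 i) => E.
have : (zet ^+ m / th c i) ^+ k.+1 = (theta i ^+ k.+1)^-1.
  rewrite expr_div_n exprAC (prim_expr_order zet_prim) expr1n mul1r.
  by rewrite (twist_exp _ zet_prim).
by rewrite E expr1n => /(congr1 GRing.inv); rewrite invr1 invrK.
Qed.

Lemma twistable_zeta_div m i : D (fun c => zet ^+ m / th c i).
Proof.
apply: twistableM; first by apply: twistable_cst; apply: rpredX.
by apply: twV => [|c]; [apply: twistable_var|apply: theta_twist_neq0].
Qed.

Lemma twistable_Li l h : (forall c, h c != 1) -> D h -> D (fun c => Li_neg l (h c)).
Proof.
move=> h_neq1 hD; have [numF denF] := polyOver_Li F l.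
apply: twistableM; first exact: twistable_horner.
by apply: twV => [|c]; [apply: twistable_horner|apply: Li_den_neq0].
Qed.

Lemma hgraded_psi i m : hgraded (fun c => psi k.+1 (xvar R i) (th c i) m).
Proof.
apply: hgraded_exp => -[|p]; first exact: graded0.
apply: graded_sum => n _; apply: graded_sum => j /eqP Enj.
have natF x : x%:R \in F by apply: rpred_nat.
apply: gradedZ; last first.
  (* The power of x is j, and 2n + j exceeds the index of the half-power of hbar by 2, so both have
     the same parity. *)
  apply: graded_odd (gradedX j (graded_xvar i)); rewrite mul1n.
  by lia.
apply: twistableM.
  apply: twistable_cst; rewrite rpred_div ?rpredX ?rpredN ?rpred1 //.
  by rewrite !rpredM ?rpredX.
apply: twistable_sum => s _; apply: twistableM.
  by apply: twistable_cst; apply: rpred_horner; rewrite ?polyOver_bernoulli ?rpred_div.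
apply: twistable_Li => [c|]; first exact: zeta_div_twist_neq1.
exact: twistable_zeta_div.
Qed.

Lemma hgraded_prefactor (B : 'M[int]_N) nu f :
  hgraded (fun=> hs_exp (log_prefactor R k.+1 B nu f)).
Proof.
have natF x : x%:R \in F by apply: rpred_nat.
apply: hgraded_exp => p; rewrite /log_prefactor.
case: eqP => [->|_].
  apply: (gradedZ (h := fun=> _)).
    by apply: twistable_cst; rewrite rpredN rpredVr // rpredM.
  apply: graded_sum => i _; apply: (gradedZ (h := fun=> _)); last exact: graded_xvar.
  by apply: twistable_cst; apply: rpred_int.
case: eqP => [->|_]; last exact: graded0.
apply: (gradedZ (h := fun=> _)); last exact: graded_odd graded1.
by apply: twistable_cst; rewrite rpredM ?rpred_int // rpredVr // rpredM.
Qed.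

Lemma hgraded_integrand (B : 'M[int]_N) nu f m :
  hgraded (fun c => integrand k.+1 B nu f (th c) m).
Proof.
apply: hgraded_mul; first exact: hgraded_prefactor.
by apply: hgraded_prod => i; apply: hgraded_psi.
Qed.

Lemma twistable_gauss p P (H : 'M[R[i]]_N) :
  (forall i j, H i j \in F) -> graded p P -> D (fun c => gauss H (P c)).
Proof.
(* The support of [P c] varies with c; the union of all supports gives a common index set, and the
   added terms have coefficient 0. *)
move=> HF Pg; pose r := undup (flatten [seq msupp (P c) | c <- enum tw]).
apply: eq_twistable (_ : twistable _ _ _ (fun c =>
  \sum_(mu <- r) mcoeff mu (P c) * wick H (in_tuple (mon_indices mu)))) => [c|].
  rewrite (bigID (fun mu => mu \in msupp (P c))) /= addrC big1 ?add0r => [|mu]; last first.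
    by rewrite mcoeff_msupp negbK => /eqP->; rewrite mul0r.
  rewrite -big_filter; apply: perm_big; apply: uniq_perm.
  - by rewrite filter_uniq ?undup_uniq.
  - exact: msupp_uniq.
  move=> mu; rewrite mem_filter mem_undup; case: (boolP (_ \in _)) => //= mu_c.
  by apply/flatten_mapP; exists c; rewrite ?mem_enum.
apply: twistable_sum => mu _; apply: twistableM; first by case: (Pg mu).
apply: twistable_cst; apply: rpred_sum => s _; apply: rpred_prod => a _; exact: HF.
Qed.

Lemma gauss_odd p P (H : 'M[R[i]]_N) c : odd p -> graded p P -> gauss H (P c) = 0.
Proof.
move=> p_odd Pg; apply: big1 => mu _; have [_ P0] := Pg mu.
case: (boolP (odd (mdeg mu))) => mu_odd.
  by rewrite wick_odd ?mulr0 // size_mon_indices.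
by rewrite P0 ?mul0r // p_odd (negPf mu_odd).
Qed.

End Families.

(** * Integer powers, determinants and inverse matrices over a subfield *)

Lemma rpredXz (K : fieldType) (F : divringClosed K) (x : K) (n : int) :
  x \in F -> x ^ n \in F.
Proof. by case: n => n xF; rewrite ?NegzE -?invr_expz ?rpredVr ?rpredX. Qed.

Section DivringClosedMatrix.
Variables (K : fieldType) (F : divringClosed K).

Lemma rpred_det n (M : 'M[K]_n) : (forall i j, M i j \in F) -> \det M \in F.
Proof.
move=> MF; apply: rpred_sum => s _; apply: rpredM.
  by rewrite rpredX // rpredN rpred1.
by apply: rpred_prod.
Qed.

Lemma rpred_invmx n (M : 'M[K]_n) :
  (forall i j, M i j \in F) -> forall i j, invmx M i j \in F.
Proof.
(* When [M] is not invertible, [invmx M] is [M] by default; otherwise the cofactor formula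
   applies. *)
move=> MF i j; rewrite /invmx; case: ifP => // _; rewrite mxE.
apply: rpredM; first by rewrite rpredVr // rpred_det.
rewrite mxE; apply: rpredM; first by rewrite rpredX // rpredN rpred1.
by apply: rpred_det => a b; rewrite !mxE.
Qed.

End DivringClosedMatrix.

(** * Constant term and shift invariance of the integrand *)

Lemma gauss1 (K : fieldType) N (H : 'M[K]_N) : gauss H 1 = 1.
Proof.
rewrite /gauss msupp1 big_seq1 mcoeff1 eqxx mul1r.
have E0 : size (mon_indices (mnm0 : multinom N)) = 0%N by rewrite size_mon_indices mdeg0.
(* The empty set has a single perfect pairing, whose product is empty. *)
rewrite /wick (big_pred1 1%g) => [|s].
  by rewrite big1 // => -[a a_lt]; exfalso; rewrite E0 in a_lt.
have I0 (a : 'I_(size (mon_indices (mnm0 : multinom N)))) : False.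
  by case: a => a; rewrite E0.
have -> : s = 1%g by apply/permP => a; case: (I0 a).
by rewrite /= eqxx; apply/forallP => a; case: (I0 a).
Qed.

Lemma hs_exp0 (K : fieldType) (V : algType K) (a : hseries V) : hs_exp a 0%N = 1.
Proof. by rewrite /hs_exp big_ord1 /= invr1 scale1r. Qed.

Lemma hs_mul0 (V : nzRingType) (a b : hseries V) : hs_mul a b 0%N = a 0%N * b 0%N.
Proof. by rewrite /hs_mul big_ord1. Qed.

Lemma integrand0 (R : realType) N k (B : 'M[int]_N) nu f (theta : 'I_N -> R[i]) m :
  integrand k B nu f theta m 0%N = 1.
Proof.
rewrite /integrand hs_mul0 hs_exp0 mul1r.
elim: (index_enum _) => [|i r IHr]; first by rewrite big_nil.
by rewrite big_cons hs_mul0 IHr mulr1 /psi hs_exp0.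
Qed.

Lemma log_psi_shift (R : realType) (V : algType R[i]) k (x : V) (th th' : R[i]) m m' :
  zeta R k ^+ m / th = zeta R k ^+ m' / th' -> log_psi k x th m = log_psi k x th' m'.
Proof.
move=> E; apply: boolp.funext => p; rewrite /log_psi; case: eqP => // _.
apply: eq_bigr => n _; apply: eq_bigr => j _; congr (_ * _ *: _).
by apply: eq_bigr => s _; rewrite !exprD !(mulrAC _ (_ ^+ s)) E.
Qed.

Lemma integrand_shift (R : realType) N k (B : 'M[int]_N) nu f
    (theta theta' : 'I_N -> R[i]) m m' :
  (forall i, zeta R k ^+ m i / theta i = zeta R k ^+ m' i / theta' i) ->
  integrand k B nu f theta m = integrand k B nu f theta' m'.
Proof.
move=> E; pose I (g : 'I_N -> hseries (mpoly N R[i])) :=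
  hs_mul (hs_exp (log_prefactor R k B nu f)) (\big[@hs_mul _/hs_one _]_(i < N) g i).
apply: (congr1 I (boolp.funext _)) => i.
exact: congr1 (log_psi_shift _ (E i)).
Qed.

(** * Invariance of the average under twists *)

Section Average.
Variables (R : realType) (F : divringClosed R[i]) (N k : nat).
Variables (A B : 'M[int]_N) (nu : 'cV[int]_N) (z theta : 'I_N -> R[i]).
Hypotheses (symAB : (A *m B^T) = (A *m B^T)^T) (B_unit : B \in unitmx).
Hypothesis parity : forall j, exists y, (A *m B^T) j j = nu j 0 + 2 * y.
Hypotheses (z_neq0 : forall i, z i != 0) (z_neq1 : forall i, z i != 1).
Hypothesis z_gluing : forall j,
  \prod_i (z i ^ A j i * (1 - (z i)^-1) ^ B j i) = (-1) ^ nu j 0.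
Hypotheses (zF : forall i, z i \in F) (zetaF : zeta R k.+1 \in F).
Hypothesis thetaX : forall i, theta i ^+ k.+1 = z i.

Let tw := {ffun 'I_N -> 'I_k.+1}.
Let zet := zeta R k.+1.
Let zet_prim : k.+1.-primitive_root zet := zeta_prim R k.
Let D (h : tw -> R[i]) := twistable F zet theta h.
Let th (c : tw) := twist zet theta c.
Let a (t : 'I_N -> R[i]) m := weight k.+1 A B nu t m.
Let rep (m : tw) (i : 'I_N) : nat := m i.

Let theta_neq0 i : theta i != 0.
Proof. by apply: contraNneq (z_neq0 i) => t0; rewrite -thetaX t0 expr0n. Qed.

Let thetaXF i : theta i ^+ k.+1 \in F. Proof. by rewrite thetaX. Qed.
Let thetaX_neq1 i : theta i ^+ k.+1 != 1. Proof. by rewrite thetaX. Qed.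
Let D_cst x : x \in F -> D (fun=> x). Proof. exact: twistable_cst. Qed.

Let thX c i : th c i ^+ k.+1 = z i.
Proof. by rewrite (twist_exp _ zet_prim). Qed.

(** [weight_add] yields the weight at the unreduced sum of m and c. A second use of it splits off
    the multiples of k+1, whose weight, taken at the twist of theta by m + c, is 1 by
    [weight_period]. *)
Lemma weight_twist c m : a (th c) (rep m) * a theta (rep c) = a theta (rep (m + c)).
Proof.
rewrite (weight_add k nu symAB B_unit _ _ theta_neq0).
pose n i := ((m i + c i) %/ k.+1)%N.
transitivity (a theta (fun i => k.+1 * n i + rep (m + c)%R i)%N).
  congr (a theta _); apply: boolp.funext => i.
  by rewrite /rep ffunE /= mulnC -divn_eq.
apply: etrans (esym (weight_add k nu symAB B_unit (fun i => k.+1 * n i)%N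
  (rep (m + c)) theta_neq0)) _.
rewrite (weight_period symAB B_unit z_neq0 z_neq1 z_gluing) ?mul1r // => i.
exact: (thX (m + c)).
Qed.

(** The pairs (theta/zeta^c, m) and (theta, m + c) have the same quotients zeta^m/theta; for such a
    [G], twisting theta amounts to shifting m. *)
Definition invariant_under_twist (G : ('I_N -> R[i]) -> ('I_N -> nat) -> R[i]) :=
  forall th1 th2 m1 m2, (forall i, zet ^+ m1 i / th1 i = zet ^+ m2 i / th2 i) ->
  G th1 m1 = G th2 m2.

(** After the shift of m by c, the factor [a theta (rep c)] does not depend on [G], so it is common
    to the numerator and the denominator of the average. *)
Lemma sum_weight_twist G c : invariant_under_twist G ->
  (\sum_(m : tw) a (th c) (rep m) * G (th c) (rep m)) * a theta (rep c) =
  \sum_(m : tw) a theta (rep m) * G theta (rep m).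
Proof.
move=> G_inv; rewrite mulr_suml [RHS](reindex_inj (addIr c)) /=.
apply: eq_bigr => m _; rewrite mulrAC weight_twist; congr (_ * _).
apply: G_inv => i; rewrite /th /twist /rep ffunE /= prim_expr_mod // exprD.
by rewrite invf_div mulrA.
Qed.

Lemma twistable_expz h (n : int) : D h -> (forall c, h c != 0) -> D (fun c => h c ^ n).
Proof.
case: n => n hD h_neq0; first exact: twistableX.
apply: (twistableV zet_prim zetaF thetaXF (twistableX _ hD)) => c.
by rewrite expf_neq0.
Qed.

Lemma twistable_weight m : D (fun c => a (th c) m).
Proof.
rewrite /a /weight; set mZ : 'cV_N := \col_i _.
(* The exponent of zeta^(1/2) is 2h, so only the power zeta^h, an element of [F], appears. *)
have [h Eh] := invmx_mul_parity symAB B_unit mZ parity.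
apply: twistableM.
  apply: D_cst; rewrite expiN expiMz expi_pi; apply: rpredM.
    by rewrite rpredVr // rpredXz // rpredN rpred1.
  by rewrite Eh exprz_2mul expi_piV_sqr rpredXz.
apply: twistable_prod => i _; apply: twistableM.
  apply: twistable_expz; first exact: twistable_var.
  by move=> c; apply: (twist_neq0 zet_prim theta_neq0).
have zthE c r : zet ^+ r * (zet / th c i) = zet ^+ r.+1 / th c i.
  by rewrite exprSr mulrA.
apply: (twistableV zet_prim zetaF thetaXF) => [|c].
  apply: twistable_prod => r _; apply: twistableD; first exact: D_cst (rpred1 F).
  apply: (eq_twistable (h := fun c => -1 * (zet ^+ r.+1 / th c i))) => [c|].
    by rewrite mulN1r zthE.
  apply: twistableM; first by apply: D_cst; rewrite rpredN rpred1.
  exact: twistable_zeta_div.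
apply/prodf_neq0 => r _; rewrite -/zet zthE subr_eq0 eq_sym.
exact: zeta_div_twist_neq1.
Qed.

(** The quotient of [num] by [den] is twistable and takes the value of the average at every twist,
    so [twistable_const] applies. *)
Lemma Av_in G : invariant_under_twist G -> weight_sum k.+1 A B nu theta != 0 ->
  (forall m, D (fun c => G (th c) m)) -> Av k.+1 A B nu theta (G theta) \in F.
Proof.
move=> G_inv S_neq0 GD.
pose num c := \sum_(m : tw) a (th c) (rep m) * G (th c) (rep m).
pose den c := \sum_(m : tw) a (th c) (rep m).
(* The case of the constant function 1; since the product is nonzero, so are the twisted denominator
   and the common factor. *)
have aS_eq c : den c * a theta (rep c) = weight_sum k.+1 A B nu theta.
  have := @sum_weight_twist (fun _ _ => 1) c (fun _ _ _ _ _ => erefl).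
  rewrite /den /weight_sum => E; under eq_bigr => m _ do rewrite -[a _ _]mulr1.
  by rewrite E; apply: eq_bigr => m _; rewrite mulr1.
have den_neq0 c : den c != 0.
  by apply: contraNneq S_neq0 => d0; rewrite -(aS_eq c) d0 mul0r.
have a_neq0 c : a theta (rep c) != 0.
  by apply: contraNneq S_neq0 => d0; rewrite -(aS_eq c) d0 mulr0.
have denD : D den by apply: twistable_sum => m _; apply: twistable_weight.
have numD : D num.
  by apply: twistable_sum => m _; apply: twistableM; [apply: twistable_weight|apply: GD].
apply: (twistable_const zet_prim thetaXF (twistableM numD
  (twistableV zet_prim zetaF thetaXF denD den_neq0))) => c.
by rewrite /Av -(aS_eq c) -(sum_weight_twist c G_inv) -mulf_div mulfV // mulr1.
Qed.

Lemma hessian_in i j : hessian k.+1 A B z i j \in F.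
Proof.
rewrite /hessian !mxE; apply: rpredM; first by rewrite rpredVr ?rpred_nat.
rewrite rpredD ?rpredN ?rpred_int //; case: eqP => _; rewrite ?mulr0n ?rpred0 //.
by rewrite mulr1n rpredVr // rpredB ?rpred1.
Qed.

Lemma phi_plus_in f p :
  weight_sum k.+1 A B nu theta != 0 -> phi_plus k.+1 A B nu f z theta p \in F.
Proof.
move=> S_neq0; pose H := invmx (hessian k.+1 A B z).
pose G t m := gauss H (integrand k.+1 B nu f t m p).
have G_inv : invariant_under_twist G.
  by move=> t1 t2 m1 m2 E; rewrite /G (integrand_shift B nu f E).
have GD m : D (fun c => G (th c) m).
  apply: (twistable_gauss (p := p)); first exact: rpred_invmx hessian_in.
  exact: (hgraded_integrand zetaF theta_neq0 thetaXF thetaX_neq1).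
exact: Av_in G_inv S_neq0 GD.
Qed.

Lemma phi_plus_odd f p : odd p -> phi_plus k.+1 A B nu f z theta p = 0.
Proof.
move=> p_odd; rewrite /phi_plus /Av big1 ?mul0r // => m _.
have tw0 : th 0 = theta by apply: boolp.funext; apply: twist0.
have := gauss_odd (invmx (hessian k.+1 A B z)) 0 p_odd
  (hgraded_integrand zetaF theta_neq0 thetaXF thetaX_neq1 B nu f (rep m) p).
by rewrite -/zet -/(th 0) tw0 => ->; rewrite mulr0.
Qed.

End Average.

(** * Constant term, vanishing of odd half-powers, and rationality over every subfield containing
    the z_i and zeta *)

Theorem theorem2p6 (R : realType) (N k : nat) (T : ideal_triangulation N)
    (A B : 'M[int]_N) (nu : 'cV[int]_N) (z : 'I_N -> R[i])
    (f f'' : 'cV[int]_N) (theta : 'I_N -> R[i])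
    (k_gt0 : (0 < k)%N)
    (gammaP : NZ_datum T A B nu z f f'')
    (B_unit : Z_nondegenerate B)
    (thetaP : forall i, theta i ^+ k = z i)
    (weight_sum_neq0 : weight_sum k A B nu theta != 0)
    (hessian_unit : hessian k A B z \in unitmx) :
  let phi := phi_plus k A B nu f z theta in
  [/\ phi 0%N = 1,
      forall p : nat, odd p -> phi p = 0 &
      forall n : nat, in_Fk k z (phi n.*2)].
Proof.
case: k k_gt0 thetaP weight_sum_neq0 hessian_unit => // k _ thetaX S_neq0 _.
case: gammaP => q [gluing [symAB _] [z_neq01 z_gluing] _ _].
have parity := gluing_matrices_parity gluing.
have z_neq0 i : z i != 0 by case: (z_neq01 i).
have z_neq1 i : z i != 1 by case: (z_neq01 i).
have in_F F : divring_closed F -> (forall i, z i \in F) -> zeta R k.+1 \in F ->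
    forall p, phi_plus k.+1 A B nu f z theta p \in F.
  move=> F_closed zF zetaF p.
  pose F' : divringClosed R[i] := HB.pack F (GRing.isDivringClosed.Build R[i] F F_closed).
  exact: (@phi_plus_in R F').
split=> [|p p_odd|n F F_closed zF zetaF]; last exact: in_F.
- rewrite /phi_plus /Av; under eq_bigr => m _ do rewrite integrand0 gauss1 mulr1.
  by rewrite divff.
(* Only the parity of the degrees matters here, so the subfield is taken to be all of C. *)
- have C_closed : divring_closed (predT : {pred R[i]}) by [].
  pose C : divringClosed R[i] :=
    HB.pack (predT : {pred R[i]}) (GRing.isDivringClosed.Build R[i] predT C_closed).
  exact: (@phi_plus_odd R C).
Qed.
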